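(* Work in either the $C^*$-setting or the $W^*$-setting. Let $X=(X(n))_{n\in\mathbb{Z}_+}$ be a standard product system, and let $T$ be a pure, completely contractive, covariant representation of $X$. Then $T$ is isometric (in the $C^*$-setting this is equivalent to $T$ extending to a $C^*$-representation) if and only if $T$ is relatively isometric.
   Context: Conventions. Hilbert spaces are complex; $C^*$-algebras need not be unital; all representations of operator algebras on Hilbert spaces are assumed nondegenerate. $\mathcal{L}(F)$ denotes the adjointable operators on a Hilbert module $F$. Two settings are considered. $C^*$-setting: $\mathcal{M}$ is a $C^*$-algebra; a correspondence over $\mathcal{M}$ is a right Hilbert $C^*$-module $F$ over $\mathcal{M}$ (inner product $\langle\cdot,\cdot\rangle$ linear in the second variable) with a left action $a\zeta=\varphi(a)\zeta$ given by a $*$-homomorphism $\varphi:\mathcal{M}\to\mathcal{L}(F)$; tensor products are interior tensor products. $W^*$-setting: $\mathcal{M}$ is a von Neumann algebra, correspondences are required to be self-dual with $\varphi$ normal, and tensor products and direct sums of correspondences mean the self-dual completions of the usual ones. For a representation $\sigma$ of $\mathcal{M}$ on $\mathcal{H}$, $F\otimes_\sigma\mathcal{H}$ is the Hilbert space with $(\zeta_1\otimes h_1,\zeta_2\otimes h_2)=(h_1,\sigma(\langle\zeta_1,\zeta_2\rangle)h_2)$. Standard product system: $X(n)=E^{\otimes n}$ for all $n\in\mathbb{Z}_+$ ($E^{\otimes0}=\mathcal{M}$), where $E$ is a correspondence over $\mathcal{M}$ whose left action is nondegenerate ($\varphi(\mathcal{M})E$ dense in $E$; in the $W^*$-setting,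 $\varphi$ unital). $X(n)\otimes X(m)$ is identified with $X(n+m)$ (using the module actions if $n$ or $m$ is $0$). Completely contractive, covariant representation of $X$ on $\mathcal{H}$: a family $T=(T_n)_{n\in\mathbb{Z}_+}$ of linear maps $T_n:X(n)\to B(\mathcal{H})$ such that $\sigma:=T_0$ is a $C^*$-representation of $\mathcal{M}$ on $\mathcal{H}$; each $T_n$ is completely contractive (with $X(n)$ viewed inside its linking algebra); $T_n(\zeta a)=T_n(\zeta)\sigma(a)$ and $T_n(a\zeta)=\sigma(a)T_n(\zeta)$; and $T_{n+m}(\zeta\otimes\eta)=T_n(\zeta)T_m(\eta)$ for $\zeta\in X(n),\eta\in X(m)$. In the $W^*$-setting $\sigma$ is also required to be normal, and each $T_n$ continuous from the $\sigma$-topology of $X(n)$ (generated by the functionals $x\mapsto\sum_i\omega_i(\langle\eta_i,x\rangle)$ with $\omega_i\in\mathcal{M}_*$, $\eta_i\in X(n)$, $\sum_i\|\omega_i\|\|\eta_i\|<\infty$) to the ultraweak topology (this continuity is automatic when $\sigma$ is normal). For each $n$, $\widetilde{T}_n:X(n)\otimes_\sigma\mathcal{H}\to\mathcal{H}$ is the contraction $\widetilde{T}_n(\zeta\otimes h)=T_n(\zeta)h$. $T$ is isometric if $\widetilde{T}_n$ is isometric for all $n$. $T$ is pure if $\widetilde{T}_n\widetilde{T}_n^*\to 0$ in the strong operator topology. $\Delta_*:=(I_{\mathcal{H}}-\widetilde{T}_1\widetilde{T}_1^* )^{1/2}$, which commutes with $\sigma(\mathcal{M})$. $T$ is relatively isometric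 if all the maps $\widetilde{T}_n$, $n\in\mathbb{Z}_+$, are partial isometries and one (equivalently, both) of the following conditions holds: (a) $X(n)\otimes_\sigma\operatorname{Im}\Delta_*\subseteq\operatorname{Im}\widetilde{T}_n^*$ for all $n\in\mathbb{Z}_+$; (b) $\Delta_*T_n(\zeta)^*T_n(\zeta)\Delta_*=\sigma(\langle\zeta,\zeta\rangle)\Delta_*$ for all $n\in\mathbb{Z}_+$, $\zeta\in X(n)$. Fock space and shift: $\mathcal{F}_X=\bigoplus_{n\in\mathbb{Z}_+}E^{\otimes n}$, and for $\zeta\in X(n)$, $S_n(\zeta)\in\mathcal{L}(\mathcal{F}_X)$ is given by $S_n(\zeta)\eta=\zeta\otimes\eta$. The Toeplitz algebra $\mathcal{T}(X)$ is the $C^*$-subalgebra of $\mathcal{L}(\mathcal{F}_X)$ generated by all $S_n(\zeta)$. $T$ extends to a $C^*$-representation if there is a $C^*$-representation $\pi$ of $\mathcal{T}(X)$ on $\mathcal{H}$ with $\pi(S_n(\zeta))=T_n(\zeta)$ for all $n\in\mathbb{Z}_+$, $\zeta\in X(n)$. *)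

(* Defs.v *)
From HB Require Import structures.
From mathcomp Require Import all_boot all_order all_algebra.
From mathcomp Require Import all_classical all_reals all_analysis.
From mathcomp Require Import complex.

Set Implicit Arguments.
Unset Strict Implicit.
Unset Printing Implicit Defensive.

Import Order.TTheory GRing.Theory Num.Theory numFieldNormedType.Exports.
Local Open Scope classical_set_scope.
Local Open Scope ring_scope.

(* [R[i]] as a [numClosedFieldType], the structure carrying the topology.    *)
Notation Cx R := (complex_complex__canonical__Num_ClosedField R)
  (only parsing).

Section Generalities.
Variable R : realType.
Local Notation C := (Cx R).

(* MathComp norms over C are C-valued (nonnegative reals of C); [rnorm] is   *)
(* the same number in R, where suprema and square roots are taken.           *)
Definition rnorm (V : normedModType C) (x : V) : R := complex.Re `|x|.

Definition bilin (U V W : lmodType C) (f : U -> V -> W) : Prop :=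
  (forall x, linear (f x)) /\ (forall y, linear (f^~ y)).

Definition bounded_op (U V : normedModType C) (f : U -> V) : Prop :=
  linear f /\ exists c : C, forall x, `|f x| <= c * `|x|.

Definition lspan (V : lmodType C) (D : set V) : set V :=
  [set x | exists n (c : 'I_n -> C) (v : 'I_n -> V),
    (forall i, D (v i)) /\ x = \sum_i c i *: v i].

Definition functional_norm (V : normedModType C) (f : V -> C) : R :=
  sup [set rnorm (f x) | x in [set x : V | `|x| <= 1]].

(* The coarsest topology on [V] making all functionals in [F] continuous.    *)
Definition functional_topology (V : choiceType) (F : set (V -> C))
    : topologicalType :=
  sup_topology (fun f : {f : V -> C | F f} =>
    Topological.on (initial_topology (sval f))).

End Generalities.

Section HilbertSpaces.
Variable R : realType.
Local Notation C := (Cx R).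

Record hilbert := Hilbert {
  hil_car :> completeNormedModType C;
  hdot : hil_car -> hil_car -> C;
  hdot_linear : forall x c y z, hdot x (c *: y + z) = c * hdot x y + hdot x z;
  hdotC : forall x y, hdot y x = (hdot x y)^*;
  hdot_norm : forall x, hdot x x = `|x| ^+ 2
}.

(* Adjoint of a bounded operator, unique when it exists (and it exists for   *)
(* every bounded operator, by the Riesz theorem).                            *)
Definition hadj (H K : hilbert) (f : H -> K) : K -> H :=
  xget (fun=> 0) [set g : K -> H | forall x y, hdot (f x) y = hdot x (g y)].

Definition positive_op (H : hilbert) (f : H -> H) : Prop :=
  bounded_op f /\ forall h, 0 <= hdot h (f h).

(* The positive square root of a positive operator.                          *)
Definition sqrt_op (H : hilbert) (f : H -> H) : H -> H :=
  xget (fun=> 0) [set g : H -> H | positive_op g /\ g \o g = f].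

Definition isometric_op (H K : hilbert) (f : H -> K) : Prop :=
  forall x, `|f x| = `|x|.

Definition partial_isometry (H K : hilbert) (f : H -> K) : Prop :=
  forall x, (forall y, f y = 0 -> hdot y x = 0) -> `|f x| = `|x|.

Definition square_summable (H : hilbert) (h : nat -> H) : Prop :=
  cvgn (series (fun i => rnorm (h i) ^+ 2)).

(* Functionals on B(H) are written on all maps H -> H; only their values at  *)
(* bounded operators, where the limit below exists, are ever used.           *)
Definition ultraweak_functional (H : hilbert) : set ((H -> H) -> C) :=
  [set rho | exists h k : nat -> H,
    [/\ square_summable h, square_summable k &
        forall f, rho f = limn (fun N => \sum_(i < N) hdot (h i) (f (k i)))]].

Definition ultraweak (H : hilbert) : topologicalType :=
  functional_topology (@ultraweak_functional H).

Definition commutant (H : hilbert) (B : set (H -> H)) : set (H -> H) :=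
  [set f | bounded_op f /\ forall g, B g -> f \o g = g \o f].

End HilbertSpaces.

Section OperatorAlgebras.
Variable R : realType.
Local Notation C := (Cx R).

Record cstar_alg := CStarAlg {
  cs_car :> completeNormedModType C;
  cmul : cs_car -> cs_car -> cs_car;
  cstar : cs_car -> cs_car;
  cmul_bilin : bilin cmul;
  cmulA : forall a b c, cmul a (cmul b c) = cmul (cmul a b) c;
  cstar_linear : forall (c : C) a b,
    cstar (c *: a + b) = c^* *: cstar a + cstar b;
  cstarK : forall a, cstar (cstar a) = a;
  cstarM : forall a b, cstar (cmul a b) = cmul (cstar b) (cstar a);
  cnormM : forall a b, `|cmul a b| <= `|a| * `|b|;
  cnorm_star : forall a, `|cmul (cstar a) a| = `|a| ^+ 2
}.

Definition star_rep (A : cstar_alg) (H : hilbert R) (pi : A -> H -> H) : Prop :=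
  [/\ linear pi /\ (forall a, bounded_op (pi a)),
      forall a b, pi (cmul a b) = pi a \o pi b,
      forall a h k, hdot (pi a h) k = hdot h (pi (cstar a) k)
    & closure (lspan [set x | exists a h, x = pi a h]) = setT].

(* [iota] identifies A with a von Neumann algebra acting on K.               *)
Definition von_neumann (A : cstar_alg) (K : hilbert R) (iota : A -> K -> K)
    : Prop :=
  [/\ star_rep iota, injective iota
    & commutant (commutant (range iota)) = range iota].

Inductive setting (M : cstar_alg) : Type :=
| CStarSetting
| WStarSetting (K : hilbert R) (iota : M -> K -> K) of von_neumann iota.

(* The predual of the von Neumann algebra iota(M).                           *)
Definition predual (M : cstar_alg) (K : hilbert R) (iota : M -> K -> K)
    : set (M -> C) :=
  [set rho \o iota | rho in @ultraweak_functional R K].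

End OperatorAlgebras.

Arguments CStarSetting {R M}.

Section HilbertModules.
Variables (R : realType) (M : cstar_alg R).
Local Notation C := (Cx R).

Record hilbert_module := HilbertModule {
  hm_car :> completeNormedModType C;
  ract : hm_car -> M -> hm_car;
  mdot : hm_car -> hm_car -> M;
  ract_bilin : bilin ract;
  ractA : forall x a b, ract x (cmul a b) = ract (ract x a) b;
  mdot_linear : forall x, linear (mdot x);
  mdot_ract : forall x y a, mdot x (ract y a) = cmul (mdot x y) a;
  mdot_star : forall x y, mdot y x = cstar (mdot x y);
  mdot_pos : forall x, exists b, mdot x x = cmul (cstar b) b;
  mdot_norm : forall x, `|mdot x x| = `|x| ^+ 2
}.

Definition adjoint_pair (F : hilbert_module) (f g : F -> F) : Prop :=
  forall x y, mdot (f x) y = mdot x (g y).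

Definition adjointable (F : hilbert_module) (f : F -> F) : Prop :=
  exists g, adjoint_pair f g.

Record correspondence := Correspondence {
  corr_mod :> hilbert_module;
  lact : M -> corr_mod -> corr_mod;
  lact_linear : linear lact;
  lactA : forall a b x, lact (cmul a b) x = lact a (lact b x);
  lact_adj : forall a, adjoint_pair (lact a) (lact (cstar a))
}.

(* M as a correspondence over itself, with <a, b> = a^* b.                   *)
Section SelfCorrespondence.

Fact self_mdot_linear (a : M) : linear (cmul (cstar a)).
Proof. exact: (cmul_bilin M).1. Qed.

Fact self_mdot_ract (a b c : M) :
  cmul (cstar a) (cmul b c) = cmul (cmul (cstar a) b) c.
Proof. exact: cmulA. Qed.

Fact self_mdot_star (a b : M) :
  cmul (cstar b) a = cstar (cmul (cstar a) b).
Proof. by rewrite cstarM cstarK. Qed.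

Fact self_ractA (x a b : M) : cmul x (cmul a b) = cmul (cmul x a) b.
Proof. exact: cmulA. Qed.

Fact self_mdot_pos (a : M) : exists b, cmul (cstar a) a = cmul (cstar b) b.
Proof. by exists a. Qed.

Definition self_module : hilbert_module :=
  HilbertModule (cmul_bilin M) self_ractA self_mdot_linear self_mdot_ract
    self_mdot_star self_mdot_pos (@cnorm_star R M).

Fact self_lact_linear : linear (@cmul R M : M -> M -> M).
Proof. by move=> c a b; apply/funext => x; exact: (cmul_bilin M).2. Qed.

Fact self_lactA (a b x : M) : cmul (cmul a b) x = cmul a (cmul b x).
Proof. by rewrite cmulA. Qed.

Fact self_lact_adj (a : M) :
  @adjoint_pair self_module (cmul a) (cmul (cstar a)).
Proof. by move=> x y; rewrite /= cstarM cmulA. Qed.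

Definition self_corr : correspondence :=
  @Correspondence self_module (@cmul R M) self_lact_linear self_lactA
    self_lact_adj.

End SelfCorrespondence.

Definition self_dual (F : hilbert_module) : Prop :=
  forall f : F -> M, bounded_op f ->
    (forall x a, f (ract x a) = cmul (f x) a) ->
    exists y, forall x, f x = mdot y x.

Section WStar.
Variables (K : hilbert R) (iota : M -> K -> K).

Definition ultraweak_alg : topologicalType :=
  functional_topology (predual iota).

Definition sigma_functional (F : hilbert_module) : set (F -> C) :=
  [set f | exists (om : nat -> M -> C) (y : nat -> F),
    [/\ forall i, predual iota (om i),
        cvgn (series (fun i => functional_norm (om i) * rnorm (y i)))
      & forall x, f x = limn (fun N => \sum_(i < N) om i (mdot (y i) x))]].

Definition sigma_topology (F : hilbert_module) : topologicalType :=
  functional_topology (@sigma_functional F).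

(* For self-dual F, L(F) is a von Neumann algebra whose predual consists of  *)
(* the functionals f |-> sum_i om_i(<y_i, f(z_i)>), with om_i in M_*.        *)
Definition ultraweak_adjointable_functional (F : hilbert_module)
    : set ((F -> F) -> C) :=
  [set rho | exists (om : nat -> M -> C) (y z : nat -> F),
    [/\ forall i, predual iota (om i),
        cvgn (series (fun i =>
          functional_norm (om i) * rnorm (y i) * rnorm (z i)))
      & forall f, rho f =
          limn (fun N => \sum_(i < N) om i (mdot (y i) (f (z i))))]].

Definition ultraweak_adjointable (F : hilbert_module) : topologicalType :=
  functional_topology (@ultraweak_adjointable_functional F).

Definition normal_left_action (F : correspondence) : Prop :=
  continuous (@lact F : ultraweak_alg -> ultraweak_adjointable F).

Definition normal_rep (H : hilbert R) (sigma : M -> H -> H) : Prop :=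
  continuous (sigma : ultraweak_alg -> ultraweak H).

End WStar.

Section Settings.
Variable s : setting M.

Definition total_in (F : hilbert_module) (D : set F) : Prop :=
  match s with
  | CStarSetting => closure (lspan D) = setT
  | WStarSetting K iota _ =>
      closure (lspan D : set (sigma_topology iota F)) = setT
  end.

Definition admissible_module (F : hilbert_module) : Prop :=
  if s is WStarSetting _ _ _ then self_dual F else True.

Definition admissible_corr (F : correspondence) : Prop :=
  if s is WStarSetting K iota _ then self_dual F /\ normal_left_action iota F
  else True.

Definition nondegenerate_corr (F : correspondence) : Prop :=
  match s with
  | CStarSetting => closure (lspan [set x : F | exists a y, x = lact a y]) = setT
  | WStarSetting _ _ _ =>
      forall e : M, (forall a, cmul e a = a /\ cmul a e = a) ->
      forall x : F, lact e x = x
  end.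

(* [t] exhibits P as the interior tensor product of F and G over M (in the   *)
(* W*-setting, as its self-dual completion).  This determines P up to a      *)
(* unique unitary isomorphism of correspondences carrying t to t'.           *)
Definition is_tensor (F G P : correspondence) (t : F -> G -> P) : Prop :=
  [/\ bilin t,
      forall x x' y y', mdot (t x y) (t x' y') = mdot y (lact (mdot x x') y'),
      forall a x y, lact a (t x y) = t (lact a x) y,
      forall a x y, ract (t x y) a = t x (ract y a)
    & total_in [set p | exists x y, p = t x y]].

End Settings.
End HilbertModules.

Section ProductSystems.
Variables (R : realType) (M : cstar_alg R) (s : setting M).

(* M, E, E (x) E, ... : the entry of index 0 is M itself.                    *)
Definition tensor_family (Y : nat -> correspondence M) (n : nat)
    : correspondence M :=
  if n is k.+1 then Y k else self_corr M.

(* X(n) = E^(n) with E = X(1).  Any model of the iterated tensor products is *)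
(* allowed: [ps_mul] is the identification X(n) (x) X(m) = X(n + m), with    *)
(* the target index p = n + m kept free to avoid casts between X(n + 0) and  *)
(* X(n), or X((n + m) + l) and X(n + (m + l)).                               *)
Record standard_product_system := StandardProductSystem {
  ps_pos : nat -> correspondence M;
  ps_fam := tensor_family ps_pos;
  ps_mul : forall n m p, (n + m)%N = p -> ps_fam n -> ps_fam m -> ps_fam p;
  ps_admissible : forall n, admissible_corr s (ps_fam n);
  ps_nondegenerate : nondegenerate_corr s (ps_fam 1%N);
  ps_tensor : forall n m p (e : (n + m)%N = p), is_tensor s (ps_mul e);
  ps_mul0l : forall n (e : (0 + n)%N = n) (a : M) (x : ps_fam n),
    ps_mul e (a : ps_fam 0%N) x = lact a x;
  ps_mul0r : forall n (e : (n + 0)%N = n) (x : ps_fam n) (a : M),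
    ps_mul e x (a : ps_fam 0%N) = ract x a;
  ps_mulA : forall n m l nm ml p (e1 : (n + m)%N = nm) (e2 : (nm + l)%N = p)
      (e3 : (m + l)%N = ml) (e4 : (n + ml)%N = p)
      (x : ps_fam n) (y : ps_fam m) (z : ps_fam l),
    ps_mul e2 (ps_mul e1 x y) z = ps_mul e4 x (ps_mul e3 y z)
}.

End ProductSystems.

Coercion ps_fam : standard_product_system >-> Funclass.

Section MatrixNorms.
Variables (R : realType) (M : cstar_alg R).

(* Norms of columns in F^k (a Hilbert module over M) and in H^k.             *)
Definition mcol_norm (F : hilbert_module M) k (x : 'I_k -> F) : R :=
  Num.sqrt (rnorm (\sum_i mdot (x i) (x i))).

Definition hcol_norm (H : hilbert R) k (h : 'I_k -> H) : R :=
  Num.sqrt (\sum_i rnorm (h i) ^+ 2).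

(* In the linking algebra of F, an element of F is the operator a |-> x a    *)
(* from M to F, so a matrix over F has its norm as an operator M^k -> F^k.   *)
Definition linking_mx_norm (F : hilbert_module M) k (x : 'I_k -> 'I_k -> F)
    : R :=
  sup [set mcol_norm (fun i => \sum_j ract (x i j) (a j))
      | a in [set a : 'I_k -> M | @mcol_norm (self_module M) k a <= 1]].

Definition op_mx_norm (H : hilbert R) k (f : 'I_k -> 'I_k -> H -> H) : R :=
  sup [set hcol_norm (fun i => \sum_j f i j (h j))
      | h in [set h : 'I_k -> H | hcol_norm h <= 1]].

Definition completely_contractive (F : hilbert_module M) (H : hilbert R)
    (T : F -> H -> H) : Prop :=
  forall k (x : 'I_k -> 'I_k -> F),
    op_mx_norm (fun i j => T (x i j)) <= linking_mx_norm x.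

End MatrixNorms.

Section Representations.
Variables (R : realType) (M : cstar_alg R) (s : setting M).
Variables (X : standard_product_system s) (H : hilbert R).

Record cc_rep := CCRep {
  rep_fun :> forall n, X n -> H -> H;
  rep_linear : forall n, linear (@rep_fun n);
  rep_bounded : forall n (x : X n), bounded_op (rep_fun x);
  rep_star_rep : star_rep (@rep_fun 0%N : M -> H -> H);
  rep_cc : forall n, completely_contractive (@rep_fun n);
  rep_ract : forall n (x : X n) (a : M),
    rep_fun (ract x a) = rep_fun x \o rep_fun (a : X 0%N);
  rep_lact : forall n (a : M) (x : X n),
    rep_fun (lact a x) = rep_fun (a : X 0%N) \o rep_fun x;
  rep_mul : forall n m p (e : (n + m)%N = p) (x : X n) (y : X m),
    rep_fun (ps_mul e x y) = rep_fun x \o rep_fun y;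
  rep_continuous :
    if s is WStarSetting K iota _ then
      normal_rep iota (@rep_fun 0%N : M -> H -> H) /\
      forall n, continuous
        (@rep_fun n : sigma_topology iota (X n) -> ultraweak H)
    else True
}.

Definition rep0 (T : cc_rep) : M -> H -> H := @rep_fun T 0%N.

(* A model of the Hilbert space F (x)_sigma H, unique up to unitary.         *)
Record hilbert_tensor (F : hilbert_module M) (sigma : M -> H -> H) :=
  HilbertTensor {
  ht_space :> hilbert R;
  htens : F -> H -> ht_space;
  htens_bilin : bilin htens;
  htens_dot : forall x y h k,
    hdot (htens x h) (htens y k) = hdot h (sigma (mdot x y) k);
  htens_total : closure (lspan [set z | exists x h, z = htens x h]) = setT
}.

Section Tilde.
Variable T : cc_rep.
Variable K : forall n, hilbert_tensor (X n) (rep0 T).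
Variable Tt : forall n, K n -> H.

Definition is_tilde : Prop :=
  forall n, [/\ linear (Tt (n:=n)),
    forall z : K n, `|Tt z| <= `|z|
  & forall x h, Tt (htens (K n) x h) = T n x h].

Definition isometric_rep : Prop := forall n, isometric_op (Tt (n:=n)).

Definition pure_rep : Prop :=
  forall h, (fun n => Tt (hadj (Tt (n:=n)) h)) @ \oo --> (0 : H).

Definition Delta_star : H -> H :=
  sqrt_op (fun h => h - Tt (hadj (Tt (n:=1%N)) h)).

Definition relatively_isometric : Prop :=
  (forall n, partial_isometry (Tt (n:=n))) /\
  ((forall n, closure (lspan [set z | exists x h, z = htens (K n) x (Delta_star h)])
       `<=` range (hadj (Tt (n:=n))))
   \/
   (forall n (x : X n) h,
     Delta_star (hadj (T n x) (T n x (Delta_star h))) =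
     rep0 T (mdot x x) (Delta_star h))).

End Tilde.

(* A model of the Fock module (the direct sum of the X(n)) with its shift.   *)
Record fock := Fock {
  fock_mod :> hilbert_module M;
  fock_admissible : admissible_module s fock_mod;
  fock_in : forall n, X n -> fock_mod;
  fock_in_linear : forall n, linear (@fock_in n);
  fock_in_ract : forall n (x : X n) a, fock_in (ract x a) = ract (fock_in x) a;
  fock_in_dot : forall n (x y : X n), mdot (fock_in x) (fock_in y) = mdot x y;
  fock_in_ortho : forall n m (x : X n) (y : X m), n != m ->
    mdot (fock_in x) (fock_in y) = 0;
  fock_total : total_in s [set z | exists n (x : X n), z = fock_in x];
  shift : forall n, X n -> fock_mod -> fock_mod;
  shift_adjointable : forall n (x : X n), adjointable (shift x);
  shiftE : forall n m (x : X n) (y : X m),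
    shift x (fock_in y) = fock_in (ps_mul (erefl (n + m)%N) x y)
}.

Section Toeplitz.
Variable F : fock.

(* C*-subalgebras of L(F); closedness is for the operator norm.              *)
Definition cstar_subalgebra (B : set (F -> F)) : Prop :=
  [/\ B `<=` @adjointable R M F,
      B (fun=> 0) /\ (forall (c : Cx R) f g, B f -> B g -> B (c *: f + g)),
      forall f g, B f -> B g -> B (f \o g),
      forall f g, B f -> adjoint_pair f g -> B g
    & forall f, adjointable f ->
        (forall e : Cx R, 0 < e -> exists2 g, B g &
           forall x, `|f x - g x| <= e * `|x|) -> B f].

Definition toeplitz : set (F -> F) :=
  [set f | forall B, cstar_subalgebra B ->
     (forall n (x : X n), B (shift (f:=F) x)) -> B f].

Definition toeplitz_rep (pi : (F -> F) -> H -> H) : Prop :=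
  [/\ forall f, toeplitz f -> bounded_op (pi f),
      forall (c : Cx R) f g, toeplitz f -> toeplitz g ->
        pi (c *: f + g) = c *: pi f + pi g,
      forall f g, toeplitz f -> toeplitz g -> pi (f \o g) = pi f \o pi g,
      forall f g, toeplitz f -> adjoint_pair f g ->
        forall h k, hdot (pi f h) k = hdot h (pi g k)
    & closure (lspan [set z | exists2 f, toeplitz f & exists h, z = pi f h])
        = setT].

Definition extends_to_toeplitz (T : cc_rep) : Prop :=
  exists pi, toeplitz_rep pi /\ forall n (x : X n), pi (shift (f:=F) x) = T n x.

End Toeplitz.
End Representations.

(* Main.v *)
(* Let [P = 1 - T~_1 T~_1^*].  When all the [T~_n] are partial isometries, [P] is
   a projection, hence [Delta_* = P], and the relative isometry says exactly that
   [T~_n^* T~_n] fixes the vectors [x (x) P h].  The orthogonal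
   complement of [Im T~_(n+1)] in [Im T~_n] is the closed span of the
   [T_n(x) P h], and purity gives a Wold decomposition: for all [n] together,
   the [T_n(x) P h] are total in [H].  They are mutually orthogonal
   for different [n] and have the Gram matrix of [X(n) (x)_sigma Im P] for equal
   [n], so that [T_m(x)^* T_m(y) = sigma(<x, y>)] can be checked on them.  Hence
   [H] is [F_X (x)_sigma Im P] and [T] is the representation induced from the
   shift: [f |-> f (x) 1] extends it to the Toeplitz algebra.  Conversely
   [S_n(x)^* S_n(y) = S_0(<x, y>)] forces a representation that extends to the
   Toeplitz algebra to be isometric. *)

Require Import Defs.
From HB Require Import structures.
From mathcomp Require Import all_boot all_order all_algebra.
From mathcomp Require Import all_classical all_reals all_analysis.
From mathcomp Require Import complex ring lra zify.

Set Implicit Arguments.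
Unset Strict Implicit.
Unset Printing Implicit Defensive.

Import Order.TTheory GRing.Theory Num.Theory numFieldNormedType.Exports.
Local Open Scope classical_set_scope.
Local Open Scope ring_scope.

(** * Norms, spans and bounded operators *)

(** Estimates in the modules come from the norm identity [|<x, x>| = |x|^2] rather than from the
    order of [M]. Polarization bounds [<x, y>] up to a factor 4, which is enough for continuity. The
    usual bound for [f (x) 1] compares [f^* f] with a multiple of the identity; here it comes from
    the growth of the powers of [f^* f], through repeated Cauchy-Schwarz in [H]. An adjointable map
    is only a function that has an adjoint, so its linearity and boundedness must be derived before
    a density argument can use it. What passes from products to all of [X(n + m)] is the vanishing
    of a matrix coefficient [(h, T(x) k)]. This is why the Wold argument is phrased through
    orthogonality, with projections taken in Hilbert spaces only. *)

Section RealNorm.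
Variable R : realType.
Local Notation C := (Cx R).

Lemma rnormE (V : normedModType C) (x : V) : `|x| = (rnorm x)%:C%C.
Proof. by rewrite /rnorm RRe_real // ger0_real. Qed.

Lemma rnorm_ge0 (V : normedModType C) (x : V) : 0 <= rnorm x.
Proof. by have := normr_ge0 x; rewrite rnormE lecR. Qed.

Lemma rnormD (V : normedModType C) (x y : V) : rnorm (x + y) <= rnorm x + rnorm y.
Proof. by have := ler_normD x y; rewrite !rnormE -rmorphD lecR. Qed.

Lemma rnormN (V : normedModType C) (x : V) : rnorm (- x) = rnorm x.
Proof. by rewrite /rnorm normrN. Qed.

Lemma rnormB (V : normedModType C) (x y : V) : rnorm (x - y) = rnorm (y - x).
Proof. by rewrite /rnorm distrC. Qed.

Lemma rnormZ (V : normedModType C) (c : C) (x : V) :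
  rnorm (c *: x) = rnorm (c : C^o) * rnorm x.
Proof. by rewrite {1}/rnorm normrZ !rnormE -rmorphM. Qed.

Lemma rnorm0 (V : normedModType C) : rnorm (0 : V) = 0.
Proof. by rewrite /rnorm normr0. Qed.

Lemma rnorm0_eq0 (V : normedModType C) (x : V) : rnorm x = 0 -> x = 0.
Proof. by move=> x0; apply/normr0_eq0; rewrite rnormE x0. Qed.

Lemma rnorm_real (r : R) : 0 <= r -> rnorm (r%:C%C : C^o) = r.
Proof. by move=> r0; rewrite /rnorm ger0_norm // lecR. Qed.

Lemma rnormM (c d : C) : rnorm (c * d : C^o) = rnorm (c : C^o) * rnorm (d : C^o).
Proof. exact: (@rnormZ C^o). Qed.

Lemma rnormJ (c : C) : rnorm (c^* : C^o) = rnorm (c : C^o).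
Proof. by rewrite /rnorm norm_conjC. Qed.

Lemma rnorm_sum (V : normedModType C) (I : Type) (r : seq I) (F : I -> V) :
  rnorm (\sum_(i <- r) F i) <= \sum_(i <- r) rnorm (F i).
Proof.
elim/big_ind2 : _ => // [|a b c d ab cd]; first by rewrite rnorm0.
by apply: le_trans (rnormD _ _) _; exact: lerD.
Qed.

Lemma closure_rnormP (V : normedModType C) (A : set V) x :
  closure A x <-> forall e : R, 0 < e -> exists2 y, A y & rnorm (x - y) < e.
Proof.
split=> [clA e e0|h B /nbhs_normP[e /= e0 eB]].
- have [] := clA (ball x e%:C%C); first by apply: nbhsx_ballx; rewrite ltcR.
  move=> y [Ay]; rewrite -ball_normE /= rnormE ltcR => ?; by exists y.
- have e0' : 0 < complex.Re e by move: e0; rewrite ltcE => /andP[].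
  have eE : e = (complex.Re e)%:C%C by rewrite RRe_real // gtr0_real.
  have [y Ay xy] := h _ e0'; exists y; split => //; apply: eB => /=.
  by rewrite rnormE eE ltcR.
Qed.

Lemma cvgn_rnormP (V : normedModType C) (u : nat -> V) l :
  u @ \oo --> l <-> forall e : R, 0 < e -> exists N, forall n, (N <= n)%N ->
    rnorm (l - u n) < e.
Proof.
split=> [/cvgrPdist_lt h e e0|h].
- have e0' : 0 < e%:C%C :> C by rewrite ltcR.
  have [N _ hN] := h _ e0'; exists N => n Nn.
  by have := hN _ Nn; rewrite /= rnormE ltcR.
- apply/cvgrPdist_lt => e e0.
  have e0' : 0 < complex.Re e by move: e0; rewrite ltcE => /andP[].
  have eE : e = (complex.Re e)%:C%C by rewrite RRe_real // gtr0_real.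
  have [N hN] := h _ e0'; exists N => // n Nn /=.
  by rewrite rnormE eE ltcR hN.
Qed.

Lemma cauchy_rnorm (V : completeNormedModType C) (u : nat -> V) :
  (forall e : R, 0 < e -> exists N, forall n, (N <= n)%N -> rnorm (u N - u n) < e) ->
  exists l : V, u @ \oo --> l.
Proof.
move=> h; apply/cvg_ex; apply: cauchy_cvg; apply/cauchyP => e e0.
have e0' : 0 < complex.Re e by move: e0; rewrite ltcE => /andP[].
have eE : e = (complex.Re e)%:C%C by rewrite RRe_real // gtr0_real.
have [N hN] := h _ e0'; exists (u N); exists N => // n Nn.
by rewrite /= -ball_normE /= rnormE eE ltcR hN.
Qed.

Lemma rnorm_small (V : normedModType C) (x : V) :
  (forall e : R, 0 < e -> rnorm x <= e) -> x = 0.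
Proof.
move=> h; apply/rnorm0_eq0/le_anti; rewrite rnorm_ge0 andbT.
by apply/ler_addgt0Pr => e e0; rewrite add0r h.
Qed.

End RealNorm.

Section Linear.
Variable R : realType.
Local Notation C := (Cx R).
Variables U V : lmodType C.
Variables (f : U -> V) (lf : linear f).

Let F : {linear U -> V} := HB.pack f (GRing.isLinear.Build _ _ _ _ _ lf).

Lemma lin0 : f 0 = 0. Proof. exact: (linear0 F). Qed.
Lemma linD x y : f (x + y) = f x + f y. Proof. exact: (linearD F). Qed.
Lemma linB x y : f (x - y) = f x - f y. Proof. exact: (linearB F). Qed.
Lemma linZ c x : f (c *: x) = c *: f x.
Proof. by rewrite -[c *: x]addr0 lf lin0 addr0. Qed.
Lemma lin_sum I (r : seq I) (E : I -> U) :
  f (\sum_(i <- r) E i) = \sum_(i <- r) f (E i).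
Proof. exact: (linear_sum F). Qed.
End Linear.

Section Spans.
Variable R : realType.
Local Notation C := (Cx R).

Definition is_subspace (V : lmodType C) (A : set V) :=
  A 0 /\ forall (c : C) x y, A x -> A y -> A (c *: x + y).

Lemma lspan_subspace (V : lmodType C) (D : set V) : is_subspace (lspan D).
Proof.
split=> [|c x y [n [a [v [Dv ->]]]] [m [b [w [Dw ->]]]]].
  by exists 0, (fun=> 0), (fun=> 0); split => [[]//|]; rewrite big_ord0.
exists (n + m)%N, (fun i => match fintype.split i with inl j => c * a j | inr j => b j end),
  (fun i => match fintype.split i with inl j => v j | inr j => w j end).
split=> [i|]; first by case: fintype.splitP.
rewrite big_split_ord /= scaler_sumr; congr (_ + _); apply: eq_bigr => i _.
- by rewrite (unsplitK (inl _ i)) scalerA.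
- by rewrite (unsplitK (inr _ i)).
Qed.

Lemma lspan_min (V : lmodType C) (D A : set V) :
  is_subspace A -> D `<=` A -> lspan D `<=` A.
Proof.
move=> [A0 AZ] DA x [n [a [v [Dv ->]]]].
by elim/big_ind: _ => // [y z Ay Az|i _]; [rewrite -[y]scale1r; exact: AZ|
  rewrite -[_ *: _]addr0; apply: AZ => //; exact: DA].
Qed.

Lemma sub_lspan (V : lmodType C) (D : set V) : D `<=` lspan D.
Proof.
move=> x Dx; exists 1%N, (fun=> 1), (fun=> x); split => //.
by rewrite big_ord1 scale1r.
Qed.

Lemma closure_closureK (V : normedModType C) (A : set V) :
  closure (closure A) = closure A.
Proof. by apply/esym/closure_id/closed_closure. Qed.

(** A form of [bounded_op] with a real constant: the order of [C] is only partial, whereas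
    inequalities in [R] chain freely. *)
Definition bounded_lin (V W : normedModType C) (f : V -> W) :=
  linear f /\ exists c : R, forall x, rnorm (f x) <= c * rnorm x.

Lemma bounded_linP (V W : normedModType C) (f : V -> W) :
  bounded_op f <-> bounded_lin f.
Proof.
split=> -[lf [c hc]]; split => //.
- exists (rnorm (c : C^o)) => x.
  have := hc x; rewrite !rnormE => h.
  have : (rnorm (f x))%:C%C <= `|c * (rnorm x)%:C%C|.
    by apply: le_trans (real_ler_norm _) => //;
      rewrite ger0_real // (le_trans _ h) // lecR rnorm_ge0.
  by rewrite normrM (@rnormE _ C^o) (@rnormE _ C^o) -rmorphM lecR rnorm_real ?rnorm_ge0.
- by exists c%:C%C => x; rewrite !rnormE -rmorphM lecR.
Qed.

Lemma bounded_lin_pos (V W : normedModType C) (f : V -> W) :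
  bounded_lin f -> exists2 c : R, 0 < c & forall x, rnorm (f x) <= c * rnorm x.
Proof.
move=> [_ [c hc]]; exists (`|c| + 1); first by have := normr_ge0 c; lra.
move=> x; apply: le_trans (hc x) _; apply: ler_wpM2r; first exact: rnorm_ge0.
by have := ler_norm c; lra.
Qed.

Lemma bounded_lin_closure (V W : normedModType C) (f : V -> W) (A : set V) (B : set W) :
  bounded_lin f -> (forall x, A x -> closure B (f x)) ->
  forall x, closure A x -> closure B (f x).
Proof.
move=> bf AB x /closure_rnormP hx.
have [c c0 hc] := bounded_lin_pos bf.
rewrite -closure_closureK; apply/closure_rnormP => e e0.
have [y Ay xy] := hx (e / c) (divr_gt0 e0 c0).
exists (f y); first exact: AB.
rewrite -(linB bf.1); apply: le_lt_trans (hc _) _.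
by rewrite mulrC -ltr_pdivlMr.
Qed.

Lemma bounded_lin_total0 (V W : normedModType C) (f : V -> W) (D : set V) :
  bounded_lin f -> (forall x, D x -> f x = 0) ->
  forall x, closure (lspan D) x -> f x = 0.
Proof.
move=> bf D0 x clx.
have : closure [set 0 : W] (f x).
  apply: (bounded_lin_closure bf _ clx) => y Dy; apply: subset_closure => /=.
  apply: (lspan_min (A := [set z | f z = 0])) Dy => //; split => /= [|a z w z0 w0].
    exact: lin0 bf.1.
  by rewrite bf.1 z0 w0 scaler0 addr0.
move=> /closure_rnormP h; apply: rnorm_small => e e0.
by have [_ -> ] := h _ e0; rewrite subr0 => /ltW.
Qed.

Lemma bounded_linB (V W : normedModType C) (f g : V -> W) :
  bounded_lin f -> bounded_lin g -> bounded_lin (fun x => f x - g x).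
Proof.
move=> [lf [c hc]] [lg [d hd]]; split=> [a x y|].
  by rewrite lf lg scalerBr opprD addrACA.
exists (c + d) => x; apply: le_trans (rnormD _ _) _; rewrite rnormN mulrDl.
exact: lerD.
Qed.

Lemma bounded_lin_comb (V W : normedModType C) (c : C) (f g : V -> W) :
  bounded_lin f -> bounded_lin g -> bounded_lin (c *: f + g).
Proof.
move=> bf bg; split=> [d x y|].
  change (c *: f (d *: x + y) + g (d *: x + y) = d *: (c *: f x + g x) + (c *: f y + g y)).
  by rewrite bf.1 bg.1 !scalerDr !scalerA mulrC addrACA.
have [c1 _ hc1] := bounded_lin_pos bf; have [c2 _ hc2] := bounded_lin_pos bg.
exists (rnorm (c : C^o) * c1 + c2) => x; apply: le_trans (rnormD _ _) _.
rewrite rnormZ mulrDl -mulrA; apply: lerD => //.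
by apply: ler_wpM2l => //; exact: rnorm_ge0.
Qed.

Lemma bounded_lin_comp (U V W : normedModType C) (g : V -> W) (f : U -> V) :
  bounded_lin f -> bounded_lin g -> bounded_lin (g \o f).
Proof.
move=> bf bg; split=> [a x y|]; first by rewrite /= bf.1 bg.1.
have [c c0 hc] := bounded_lin_pos bf; have [d d0 hd] := bounded_lin_pos bg.
exists (d * c) => x; apply: le_trans (hd _) _; rewrite -mulrA.
by rewrite ler_pM2l.
Qed.

Lemma bounded_lin_eq (V W : normedModType C) (f g : V -> W) (D : set V) :
  bounded_lin f -> bounded_lin g -> closure (lspan D) = setT ->
  (forall x, D x -> f x = g x) -> f =1 g.
Proof.
move=> bf bg tD fg x; apply/eqP; rewrite -subr_eq0; apply/eqP.
apply: (bounded_lin_total0 (bounded_linB bf bg) (D := D)); last by rewrite tD.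
by move=> y Dy; rewrite fg // subrr.
Qed.

End Spans.

(** * Sesquilinear forms *)

(** The ratio 1/9 is the one that [adjoint_bounded] calls for; elsewhere it is just a convenient
    rate of convergence. *)
Lemma geometric_small (R : realType) (e : R) : 0 < e -> exists n, (9^-1 : R) ^+ n < e.
Proof.
move=> e0; have [n hn] := ltr_add_invr e0.
exists n.+1; apply: le_lt_trans hn; rewrite add0r exprVn lef_pV2 ?posrE ?exprn_gt0 //.
by rewrite -natrX ler_nat; elim: n => // n IH; rewrite expnS; lia.
Qed.

Section Sesquilinear.
Variable R : realType.
Local Notation C := (Cx R).
Variables (V W : normedModType C) (q : V -> V -> W).
Hypothesis q_lin : forall x, linear (q x).
Hypothesis q_conj : forall (c : C) x y z, q (c *: x + y) z = c^* *: q x z + q y z.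
Hypothesis q_norm : forall x, rnorm (q x x) = rnorm x ^+ 2.

(** Polarization: [4 q(u, v)] is the sum of [c^* q(u + c v, u + c v)] over the fourth roots of unity
    [c], so [|q(u, v)| <= (|u| + |v|)^2]; unit vectors give the constant 4. This stands in for
    Cauchy-Schwarz when [q] has values in [M]. *)
Lemma sesquilinear_bound x y : rnorm (q x y) <= 4 * rnorm x * rnorm y.
Proof.
have qD u v z : q (u + v) z = q u z + q v z.
  by rewrite -[u in LHS]scale1r q_conj rmorph1 scale1r.
have q0l z : q 0 z = 0 by apply: (addrI (q 0 z)); rewrite -qD !addr0.
have qZ c u z : q (c *: u) z = c^* *: q u z.
  by rewrite -[c *: u]addr0 q_conj q0l addr0.
have [x0|x0] := eqVneq (rnorm x) 0.
  by rewrite (rnorm0_eq0 x0) q0l !rnorm0 mulr0 mul0r.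
have [y0|y0] := eqVneq (rnorm y) 0.
  by rewrite (rnorm0_eq0 y0) (lin0 (q_lin x)) !rnorm0 mulr0.
have quad u v : rnorm (q u v) <= (rnorm u + rnorm v) ^+ 2.
  pose S (c : C) := c^* *: q (u + c *: v) (u + c *: v).
  have SE c : c * c^* = 1 ->
      S c = c^* *: (q u u + q v v) + (q u v + c^* ^+ 2 *: q v u).
    move=> cc; rewrite /S qD qZ !(linD (q_lin _)) !(linZ (q_lin _)) !scalerDr !scalerA.
    rewrite [c^* * c]mulrC cc scale1r -mulrA [c^* * c]mulrC cc mulr1 -expr2.
    by rewrite [X in _ + X = _]addrC addrACA.
  have SN c : c * c^* = 1 -> S c + S (- c) = (q u v + c^* ^+ 2 *: q v u) *+ 2.
    move=> cc; rewrite !SE // ?rmorphN ?mulrNN //= sqrrN scaleNr addrACA subrr add0r.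
    by rewrite mulr2n.
  have four : (q u v) *+ 4 = S 1 + S (- 1) + (S 'i + S (- 'i)).
    rewrite !SN ?rmorph1 ?mulr1 // ?conjCi ?mulrN -?expr2 ?sqrCi ?opprK //.
    by rewrite -mulrnDl expr1n sqrrN sqrCi scaleN1r scale1r addrACA subrr addr0 -mulr2n -mulrnA.
  have Sle c : c * c^* = 1 -> rnorm (S c) <= (rnorm u + rnorm v) ^+ 2.
    move=> cc; have nc : rnorm (c : C^o) = 1.
      apply/eqP; rewrite -(@eqrXn2 _ 2) ?rnorm_ge0 // expr1n expr2 -{2}rnormJ -rnormM cc.
      by rewrite /rnorm normr1.
    rewrite /S rnormZ rnormJ nc mul1r q_norm lerXn2r ?nnegrE ?addr_ge0 ?rnorm_ge0 //.
    by apply: le_trans (rnormD _ _) _; rewrite rnormZ nc mul1r.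
  have : rnorm (q u v *+ 4) <= 4 * (rnorm u + rnorm v) ^+ 2.
    rewrite four.
    have S1 : rnorm (S 1) <= (rnorm u + rnorm v) ^+ 2 by apply: Sle; rewrite rmorph1 mulr1.
    have S2 : rnorm (S (-1)) <= (rnorm u + rnorm v) ^+ 2.
      by apply: Sle; rewrite rmorphN rmorph1 mulrNN mulr1.
    have S3 : rnorm (S 'i) <= (rnorm u + rnorm v) ^+ 2.
      by apply: Sle; rewrite conjCi mulrN -expr2 sqrCi opprK.
    have S4 : rnorm (S (- 'i)) <= (rnorm u + rnorm v) ^+ 2.
      by apply: Sle; rewrite rmorphN /= conjCi opprK mulNr -expr2 sqrCi opprK.
    have := rnormD (S 1 + S (-1)) (S 'i + S (- 'i)).
    have := rnormD (S 1) (S (-1)); have := rnormD (S 'i) (S (-'i)).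
    by lra.
  rewrite -scaler_nat rnormZ (_ : 4%:R = (4 : R)%:C%C); last by rewrite rmorph_nat.
  by rewrite rnorm_real ?ler_pM2l.
have px : 0 < rnorm x by rewrite lt_def x0 rnorm_ge0.
have py : 0 < rnorm y by rewrite lt_def y0 rnorm_ge0.
have := quad ((rnorm x)^-1%:C%C *: x) ((rnorm y)^-1%:C%C *: y).
rewrite qZ (linZ (q_lin _)) !rnormZ rnormJ !rnorm_real ?invr_ge0 ?rnorm_ge0 //.
rewrite !mulVf // mulrA -invfM mulrC ler_pdivrMr ?mulr_gt0 // => h.
by apply: le_trans h _; lra.
Qed.

Lemma sesquilinear_nondegenerate x : (forall y, q x y = 0) -> x = 0.
Proof.
by move=> /(_ x) /(congr1 (@rnorm R W)) /eqP; rewrite q_norm rnorm0 sqrf_eq0 => /eqP/rnorm0_eq0.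
Qed.

Lemma sesquilinearB x y z : q (x - y) z = q x z - q y z.
Proof. by rewrite -scaleN1r addrC q_conj rmorphN rmorph1 scaleN1r addrC. Qed.

(** Against each [z], the failure of [f] to be linear becomes that of [q] in its first argument at
    [g z], which is zero; nondegeneracy concludes. *)
Lemma adjoint_linear (f g : V -> V) : (forall x y, q (f x) y = q x (g y)) -> linear f.
Proof.
move=> fg c x y; apply/eqP; rewrite -subr_eq0; apply/eqP/sesquilinear_nondegenerate => z.
by rewrite sesquilinearB q_conj !fg q_conj subrr.
Qed.
End Sesquilinear.

(* Hellinger-Toeplitz, by Sokal's gliding-hump argument: if [f] were unbounded,
   suitable unit vectors [x n] would make the pointwise bounded functionals
   [q (f (x n))] blow up along the partial sums [y n]. *)
Lemma adjoint_bounded (R : realType) (V : completeNormedModType (Cx R))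
    (W : normedModType (Cx R)) (q : V -> V -> W)
    (q_lin : forall x, linear (q x))
    (q_conj : forall (c : Cx R) x y z, q (c *: x + y) z = c^* *: q x z + q y z)
    (q_norm : forall x, rnorm (q x x) = rnorm x ^+ 2) (f g : V -> V) :
  (forall x y, q (f x) y = q x (g y)) -> bounded_lin f.
Proof.
move=> fg; have lf := adjoint_linear q_conj q_norm fg; split=> //.
apply: contrapT => unb.
(* The growth [n * 9 ^ n] outruns the decay of the steps chosen below: [r ^+ n * t n] stays at least
   [n]. *)
have big (n : nat) : exists x, rnorm x <= 1 /\ n%:R * 9 ^+ n < rnorm (f x).
  apply: contrapT => /forallNP h; apply: unb; exists (n%:R * 9 ^+ n) => x.
  have [x0|x0] := eqVneq (rnorm x) 0.
    by rewrite (rnorm0_eq0 x0) (lin0 lf) !rnorm0 mulr0.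
  have px : 0 < rnorm x by rewrite lt_def x0 rnorm_ge0.
  have := h ((rnorm x)^-1%:C%C *: x); rewrite (linZ lf) !rnormZ.
  rewrite rnorm_real ?invr_ge0 ?rnorm_ge0 // mulVf //.
  move=> /not_andP[//|/negP]; rewrite -leNgt.
  by rewrite mulrC ler_pdivrMr.
have [x hx] := choice big.
pose t n := rnorm (f (x n)).
have t0 n : 0 < t n.
  by apply: le_lt_trans (hx n).2; rewrite mulr_ge0 // exprn_ge0.
(* The ratio matches the constant 4 of [sesquilinear_bound]: the steps after the [n]-th have total
   length at most [r ^+ n / 8], so they change [q (f (x n))] by at most half of [r ^+ n * t n]. *)
pose r : R := 9^-1.
pose step n : V := (r ^+ n / t n)%:C%C *: f (x n).
(* The values of [q (f (x n))] at [y + step n] and [y - step n] differ by a vector of norm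
   [2 * (r ^+ n * t n)], so at one of the two points the norm is at least [r ^+ n * t n]. *)
pose next n y : V := if rnorm (q (f (x n)) (y + step n)) < r ^+ n * t n
  then y - step n else y + step n.
pose y n : V := nat_rect (fun=> V) 0 next n.
have r0 n : 0 < r ^+ n by rewrite exprn_gt0 // invr_gt0.
have stepn n : rnorm (step n) = r ^+ n.
  rewrite /step rnormZ rnorm_real; last by rewrite divr_ge0 ?ltW.
  by rewrite -/(t n) divfK // gt_eqF.
have qstep n : rnorm (q (f (x n)) (step n)) = r ^+ n * t n.
  rewrite /step (linZ (q_lin _)) rnormZ q_norm rnorm_real; last by rewrite divr_ge0 ?ltW.
  by rewrite -/(t n) expr2 mulrA divfK // gt_eqF.
have ystep n : rnorm (y n.+1 - y n) = r ^+ n.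
  rewrite /y /= -/(y n) /next; case: ifP => _.
    by rewrite addrAC subrr add0r rnormN stepn.
  by rewrite addrAC subrr add0r stepn.
have qy n : r ^+ n * t n <= rnorm (q (f (x n)) (y n.+1)).
  rewrite /y /= -/(y n) /next; case: ifP => [h|/negbT]; last by rewrite -leNgt.
  have := rnormD (q (f (x n)) (y n + step n)) (- q (f (x n)) (y n - step n)).
  rewrite rnormN -(linB (q_lin _)) opprB [X in q _ X]addrC addrA subrK.
  rewrite -mulr2n -scaler_nat (linZ (q_lin _)) rnormZ qstep.
  rewrite (_ : 2%:R = (2 : R)%:C%C); last by rewrite rmorph_nat.
  by rewrite rnorm_real //; lra.
have ydist n k : rnorm (y n - y (n + k)%N) <= 9 / 8 * (r ^+ n - r ^+ (n + k)).
  elim: k => [|k IH]; first by rewrite addn0 !subrr rnorm0 mulr0.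
  have := rnormD (y n - y (n + k)%N) (y (n + k)%N - y (n + k.+1)%N).
  rewrite addrA subrK rnormB addnS [rnorm (y (n + k)%N - _)]rnormB ystep rnormB => h.
  apply: le_trans h _; rewrite exprS; move: IH; rewrite /r.
  by move: (rnorm _) => a; move: (_ ^+ (n + k)) => b; move: (_ ^+ n) => d; lra.
have ydist' n m : (n <= m)%N -> rnorm (y n - y m) <= 9 / 8 * r ^+ n.
  move=> /subnKC <-; apply: le_trans (ydist _ _) _.
  by have := r0 (n + (m - n))%N; lra.
have [l yl] : exists l : V, y @ \oo --> l.
  apply: cauchy_rnorm => e e0.
  have [N hN] := geometric_small (divr_gt0 e0 (ltr0Sn R 1)).
  exists N => n Nn; apply: le_lt_trans (ydist' _ _ Nn) _.
  by move: hN; rewrite -/r; have := r0 N; lra.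
have dl n : rnorm (l - y n) <= 9 / 8 * r ^+ n.
  apply/ler_addgt0Pr => e e0.
  have [N hN] := (cvgn_rnormP _ _).1 yl _ e0.
  have := hN _ (leq_maxl N n); have := ydist' _ _ (leq_maxr N n).
  have := rnormD (l - y (maxn N n)) (y (maxn N n) - y n).
  rewrite addrA subrK [rnorm (y (maxn N n) - _)]rnormB.
  by lra.
have lower n : n%:R / 2 <= rnorm (q (f (x n)) l).
  have h1 := qy n.
  have h2 := sesquilinear_bound q_lin q_conj q_norm (f (x n)) (l - y n.+1).
  have h3 := dl n.+1; have h4 := (hx n).2.
  have h5 := rnormD (q (f (x n)) l) (- q (f (x n)) (l - y n.+1)).
  move: h5; rewrite rnormN -(linB (q_lin _)) opprB addrC subrK => h5.
  have h6 : rnorm (f (x n)) * rnorm (l - y n.+1) <= t n * (r ^+ n / 8).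
    apply: ler_wpM2l; first exact: rnorm_ge0.
    by apply: le_trans h3 _; rewrite exprS; move: (r ^+ n) => a; rewrite /r; lra.
  have h7 : n%:R <= r ^+ n * t n.
    rewrite /r exprVn mulrC ler_pdivlMr ?exprn_gt0 //; exact: ltW.
  by move: h2; rewrite -mulrA; lra.
(* The adjoint bounds [q (f (x n)) l = q (x n) (g l)] by [4 * rnorm (g l)] for all [n], against the
   lower bound [n / 2]; hence the 8. *)
have [n hn] : exists n : nat, 8 * rnorm (g l) < n%:R.
  by exists (Num.bound (8 * rnorm (g l))); apply: archi_boundP; rewrite mulr_ge0 ?rnorm_ge0.
have := lower n; rewrite fg.
have := sesquilinear_bound q_lin q_conj q_norm (x n) (g l).
have : rnorm (x n) * rnorm (g l) <= rnorm (g l).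
  by rewrite -[leRHS]mul1r; apply: ler_wpM2r; [exact: rnorm_ge0|exact: (hx n).1].
by rewrite -mulrA; lra.
Qed.

(** * Hilbert spaces *)

Section Hilbert.
Variable R : realType.
Local Notation C := (Cx R).

Section Dot.
Variable H : hilbert R.
Implicit Types (x y z : H) (c : C).

Lemma hdot_lin x : linear (hdot x : H -> C^o).
Proof. by move=> c y z; exact: hdot_linear. Qed.

Lemma hdotDr x y z : hdot x (y + z) = hdot x y + hdot x z.
Proof. exact: (linD (hdot_lin x)). Qed.
Lemma hdotBr x y z : hdot x (y - z) = hdot x y - hdot x z.
Proof. exact: (linB (hdot_lin x)). Qed.
Lemma hdotZr x c y : hdot x (c *: y) = c * hdot x y.
Proof. exact: (linZ (hdot_lin x)). Qed.
Lemma hdot0r x : hdot x 0 = 0.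
Proof. exact: (lin0 (hdot_lin x)). Qed.

Lemma hdotDl x y z : hdot (y + z) x = hdot y x + hdot z x.
Proof. by rewrite hdotC hdotDr rmorphD /= -!hdotC. Qed.
Lemma hdotBl x y z : hdot (y - z) x = hdot y x - hdot z x.
Proof. by rewrite hdotC hdotBr rmorphB /= -!hdotC. Qed.
Lemma hdotZl x c y : hdot (c *: y) x = c^* * hdot y x.
Proof. by rewrite hdotC hdotZr rmorphM /= -!hdotC. Qed.
Lemma hdot0l x : hdot 0 x = 0.
Proof. by rewrite hdotC hdot0r rmorph0. Qed.

Lemma hdotxx x : hdot x x = (rnorm x ^+ 2)%:C%C.
Proof. by rewrite hdot_norm rnormE -rmorphXn. Qed.

Lemma hdot_eq0 x : (forall y, hdot x y = 0) -> x = 0.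
Proof.
move=> /(_ x)/eqP; rewrite hdotxx => /eqP[/eqP].
by rewrite sqrf_eq0 => /eqP/rnorm0_eq0.
Qed.

Lemma hdot_sym0 x y : hdot x y = 0 -> hdot y x = 0.
Proof. by move=> xy; rewrite hdotC xy rmorph0. Qed.

Lemma hdot_inj x y : (forall z, hdot x z = hdot y z) -> x = y.
Proof.
move=> h; apply/eqP; rewrite -subr_eq0; apply/eqP/hdot_eq0 => z.
by rewrite hdotBl h subrr.
Qed.

(** Pythagoras for the perpendicular from [x] to the line of [y]. It contains Cauchy-Schwarz, and
    measures the gain of a correction along [y] in [exists_projection]. *)
Lemma rnorm_orthogonal_part x y : y != 0 ->
  rnorm (x - (hdot y x / hdot y y) *: y) ^+ 2 =
  rnorm x ^+ 2 - rnorm (hdot y x : C^o) ^+ 2 / rnorm y ^+ 2.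
Proof.
move=> y0; have ry0 : rnorm y != 0 by apply: contra_neq y0 => /rnorm0_eq0.
apply: complexI; rewrite -hdotxx hdotBl !hdotBr !hdotZr !hdotZl.
rewrite rmorphB /= -hdotxx.
have -> : (rnorm (hdot y x : C^o) ^+ 2 / rnorm y ^+ 2)%:C%C =
    hdot y x * (hdot y x)^* / hdot y y.
  by rewrite fmorph_div /= -hdotxx rmorphXn /= -(@rnormE _ C^o) normCK.
have s0 : hdot y y != 0 by rewrite hdotxx rmorphXn expf_neq0 // fmorph_eq0.
have ss : (hdot y y)^* = hdot y y by rewrite -hdotC.
rewrite [hdot x y]hdotC fmorph_div /= ss; move: s0.
move: (hdot y y) (hdot y x) ((hdot y x)^*) (hdot x x) => s a b d s0.
by field.
Qed.

Lemma cauchy_schwarz x y : rnorm (hdot y x : C^o) <= rnorm y * rnorm x.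
Proof.
have [->|y0] := eqVneq y 0; first by rewrite hdot0l !rnorm0 mul0r.
have ry0 : 0 < rnorm y.
  by rewrite lt_def rnorm_ge0 andbT; apply: contra_neq y0 => /rnorm0_eq0.
have := rnorm_orthogonal_part x y0.
have := sqr_ge0 (rnorm (x - (hdot y x / hdot y y) *: y)) => + h.
rewrite h subr_ge0 ler_pdivrMr ?exprn_gt0 // mulrC -exprMn => h2.
by rewrite -(@ler_pXn2r _ 2) // nnegrE ?mulr_ge0 ?rnorm_ge0.
Qed.

Lemma hdot_bounded x : bounded_lin (hdot x : H -> C^o).
Proof. by split; [exact: hdot_lin|exists (rnorm x) => y; exact: cauchy_schwarz]. Qed.

Lemma closure_orthogonal (D : set H) x y :
  (forall z, D z -> hdot x z = 0) -> closure (lspan D) y -> hdot x y = 0.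
Proof. by move=> h; exact: (bounded_lin_total0 (hdot_bounded x)). Qed.

Lemma total_orthogonal0 (D : set H) x : closure (lspan D) = setT ->
  (forall z, D z -> hdot x z = 0) -> x = 0.
Proof. by move=> tD h; apply: hdot_eq0 => y; apply: closure_orthogonal h _; rewrite tD. Qed.

(** [b] is the limit of a minimizing sequence in [A], which may fail to be closed. Nearly minimal
    means nearly orthogonal ([key]), and this gives both the Cauchy property and orthogonality in
    the limit. *)
Lemma exists_projection (A : set H) (sA : is_subspace A) z :
  exists2 b, closure A b & forall u, closure A u -> hdot u (z - b) = 0.
Proof.
pose S := [set rnorm (z - v) ^+ 2 | v in A].
have S0 : S !=set0 by exists (rnorm (z - 0) ^+ 2); exists 0 => //; exact: sA.1.
have lbS : has_lbound S by exists 0 => _ [v _ <-]; rewrite sqr_ge0.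
have infS : has_inf S by [].
have [e [e0 e_anti e_small]] : exists e : nat -> R, [/\ forall n, 0 < e n,
    forall m n, (m <= n)%N -> e n <= e m & forall r, 0 < r -> exists n, e n < r].
  exists (fun n => n.+1%:R^-1); split=> [n|m n mn|r /ltr_add_invr[k]] //.
    by rewrite lef_pV2 ?posrE // ler_nat ltnS.
  by rewrite add0r; exists k.
have near_inf n : exists v, A v /\ rnorm (z - v) ^+ 2 < inf S + e n ^+ 2.
  have en0 : 0 < e n ^+ 2 by rewrite exprn_gt0.
  by have [_ [v Av <-] ?] := inf_adherent en0 infS; exists v.
have [v hv] := choice near_inf.
(* The best multiple of [u] added to [v n] lowers the squared distance by
   [|<u, z - v n>|^2 / |u|^2], which cannot exceed [e n ^+ 2]. *)
have key n u : A u -> rnorm (hdot u (z - v n) : C^o) <= rnorm u * e n.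
  move=> Au; have [->|u0] := eqVneq u 0; first by rewrite hdot0l !rnorm0 mul0r.
  have ru0 : 0 < rnorm u.
    by rewrite lt_def rnorm_ge0 andbT; apply: contra_neq u0 => /rnorm0_eq0.
  pose t := hdot u (z - v n) / hdot u u.
  have : inf S <= rnorm (z - (t *: u + v n)) ^+ 2.
    by apply: ge_inf => //; exists (t *: u + v n) => //; apply: sA.2 => //; exact: (hv n).1.
  rewrite [t *: u + _]addrC opprD addrA rnorm_orthogonal_part // lerBrDr => h.
  have := le_lt_trans h (hv n).2; rewrite ltrD2l => /ltW.
  rewrite ler_pdivrMr ?exprn_gt0 // -exprMn mulrC.
  by rewrite ler_pXn2r // nnegrE ?mulr_ge0 ?rnorm_ge0 ?ltW.
have AB x y : A x -> A y -> A (x - y).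
  by move=> Ax Ay; rewrite addrC -scaleN1r; apply: sA.2.
(* [key] at both [n] and [m], for [u = v n - v m], takes the place of the parallelogram law. *)
have vdist n m : (n <= m)%N -> rnorm (v n - v m) <= 2 * e n.
  move=> nm; have [->|d0] := eqVneq (v n - v m) 0.
    by rewrite rnorm0 mulr_ge0 // ltW.
  have rd0 : 0 < rnorm (v n - v m).
    by rewrite lt_def rnorm_ge0 andbT; apply: contra_neq d0 => /rnorm0_eq0.
  have Ad : A (v n - v m) by apply: AB; [exact: (hv n).1|exact: (hv m).1].
  have h1 := key n _ Ad; have h2 := key m _ Ad.
  have : rnorm (v n - v m) ^+ 2 <= rnorm (v n - v m) * (2 * e n).
    rewrite -[leLHS](@rnorm_real R) ?sqr_ge0 // -hdotxx.
    have {2}-> : v n - v m = (z - v m) - (z - v n) by rewrite opprB [RHS]addrC addrA subrK.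
    rewrite hdotBr; apply: le_trans (@rnormD _ C^o _ _) _; rewrite rnormN.
    have : rnorm (v n - v m) * e m <= rnorm (v n - v m) * e n by rewrite ler_pM2l // e_anti.
    by move: h1 h2; lra.
  by rewrite expr2 ler_pM2l.
have [b vb] : exists b : H, v @ \oo --> b.
  apply: cauchy_rnorm => r r0.
  have [N hN] := e_small _ (divr_gt0 r0 (ltr0Sn R 1)).
  by exists N => n Nn; apply: le_lt_trans (vdist _ _ Nn) _; move: hN; lra.
exists b.
  apply/closure_rnormP => r r0; have [N hN] := (cvgn_rnormP _ _).1 vb _ r0.
  by exists (v N); [exact: (hv N).1|exact: hN].
suff h u : A u -> hdot u (z - b) = 0.
  move=> u clu; apply: hdot_sym0.
  apply: (@closure_orthogonal A); last exact: closureS (@sub_lspan _ _ _) _ clu.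
  by move=> w Aw; apply: hdot_sym0; exact: h.
move=> Au; apply: (@rnorm_small _ C^o) => r r0.
pose d := r / (2 * (rnorm u + 1)).
have u0 := rnorm_ge0 u.
have d0 : 0 < d by rewrite divr_gt0 // mulr_gt0 //; lra.
have [N1 hN1] := (cvgn_rnormP _ _).1 vb _ d0; have [N2 hN2] := e_small _ d0.
pose n := maxn N1 N2.
have -> : z - b = (z - v n) - (b - v n) by rewrite opprB addrA subrK.
rewrite hdotBr; apply: le_trans (@rnormD _ C^o _ _) _; rewrite rnormN.
have h1 := key n _ Au; have h2 := cauchy_schwarz (b - v n) u.
have h3 : rnorm (b - v n) <= d by apply/ltW/hN1/leq_maxl.
have h4 : e n <= d by apply: le_trans (ltW hN2); apply/e_anti/leq_maxr.
have h5 := ler_wpM2l u0 h3; have h6 := ler_wpM2l u0 h4.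
have : rnorm u * d <= r / 2.
  rewrite /d (_ : r / 2 = (rnorm u + 1) * (r / (2 * (rnorm u + 1)))); last by field; lra.
  by apply: ler_wpM2r; [exact: ltW|lra].
by lra.
Qed.

Lemma riesz (phi : H -> C) : bounded_lin (phi : H -> C^o) ->
  exists g, forall x, phi x = hdot g x.
Proof.
move=> bphi; have lphi := bphi.1.
pose A := [set x | phi x = 0].
have sA : is_subspace A.
  split; first exact: (lin0 lphi).
  by move=> c x y /= x0 y0; rewrite /A /= lphi x0 y0 scaler0 addr0.
have clA x : closure A x -> phi x = 0.
  move=> clx; apply: (bounded_lin_total0 bphi (D := A)) => //.
  exact: closureS (@sub_lspan _ _ _) _ clx.
have [phi0|/existsNP[z phiz]] := pselect (forall x, phi x = 0).
  by exists 0 => x; rewrite phi0 hdot0l.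
have [b clb orth] := exists_projection sA z.
pose w := z - b.
have phiw : phi w != 0 by rewrite /w (linB lphi) (clA _ clb) subr0; apply/eqP.
have w0 : hdot w w != 0.
  rewrite hdotxx rmorphXn expf_neq0 // fmorph_eq0.
  by apply: contra_neq phiw => /rnorm0_eq0 ->; exact: (lin0 lphi).
exists (((phi w)^* / hdot w w) *: w) => x.
rewrite hdotZl fmorph_div /= conjCK -[(hdot w w)^*]hdotC.
have Ak : A (x - (phi x / phi w) *: w).
  by rewrite /A /= (linB lphi) (linZ lphi) /GRing.scale /= divfK // subrr.
have := orth _ (subset_closure Ak); rewrite -/w => /hdot_sym0.
rewrite hdotBr hdotZr => /eqP; rewrite subr_eq0 => /eqP ->.
by field; apply/andP.
Qed.

End Dot.
End Hilbert.

(** * Adjoints, contractions and square roots *)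

Lemma conjC_real (R : realType) (r : R) : (r%:C%C : Cx R)^* = r%:C%C.
Proof. by rewrite conj_Creal //; apply/complex_realP; exists r. Qed.

Section Operators.
Variable R : realType.
Local Notation C := (Cx R).

Section Adjoint.
Variables (H K : hilbert R) (f : H -> K).
Hypothesis bf : bounded_lin f.

Lemma exists_adjoint : exists g : K -> H, forall x y, hdot (f x) y = hdot x (g y).
Proof.
have h y : exists g, forall x, hdot y (f x) = hdot g x.
  exact: riesz (bounded_lin_comp bf (hdot_bounded y)).
have [g hg] := choice h; exists g => x y.
by rewrite hdotC hg -hdotC.
Qed.

Lemma hadjP x y : hdot (f x) y = hdot x (hadj f y).
Proof.
have [g hg] := exists_adjoint.
exact: (xgetPex (P := [set g : K -> H | forall x y, hdot (f x) y = hdot x (g y)])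
  (fun=> 0) (ex_intro _ g hg)).
Qed.

Lemma hadjP_sym x y : hdot (hadj f y) x = hdot y (f x).
Proof. by rewrite hdotC -hadjP -hdotC. Qed.

Lemma hadj_linear : linear (hadj f).
Proof.
move=> c x y; apply: hdot_inj => z.
by rewrite hadjP_sym hdotDl !hdotZl hdotDl hdotZl !hadjP_sym.
Qed.

Lemma hadj_bound (c : R) : (forall x, rnorm (f x) <= c * rnorm x) -> 0 <= c ->
  forall y, rnorm (hadj f y) <= c * rnorm y.
Proof.
move=> hc c0 y; have [->|y0] := eqVneq (hadj f y) 0.
  by rewrite rnorm0 mulr_ge0 ?rnorm_ge0.
have p : 0 < rnorm (hadj f y).
  by rewrite lt_def rnorm_ge0 andbT; apply: contra_neq y0 => /rnorm0_eq0.
rewrite -(ler_pM2l p) -expr2.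
have <- : rnorm (hdot (f (hadj f y)) y : C^o) = rnorm (hadj f y) ^+ 2.
  by rewrite hadjP hdotxx rnorm_real // sqr_ge0.
apply: le_trans (cauchy_schwarz _ _) _; rewrite mulrCA mulrA.
by apply: ler_wpM2r; [exact: rnorm_ge0|exact: hc].
Qed.

Lemma hadj_bounded : bounded_lin (hadj f).
Proof.
have [c c0 hc] := bounded_lin_pos bf; split; first exact: hadj_linear.
by exists c => y; apply: hadj_bound => //; exact: ltW.
Qed.

End Adjoint.

Section Contraction.
Variables (H K : hilbert R) (f : H -> K).
Hypothesis lf : linear f.
Hypothesis cf : forall x, `|f x| <= `|x|.

Lemma contraction_rnorm x : rnorm (f x) <= rnorm x.
Proof. by have := cf x; rewrite !rnormE lecR. Qed.

Lemma contraction_bounded : bounded_lin f.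
Proof. by split => //; exists 1 => x; rewrite mul1r contraction_rnorm. Qed.

Lemma hadj_contraction y : rnorm (hadj f y) <= rnorm y.
Proof.
rewrite -[leRHS]mul1r; apply: hadj_bound => //; first exact: contraction_bounded.
by move=> x; rewrite mul1r contraction_rnorm.
Qed.

(** [|f^* f x - x|^2] expands to [|f^* f x|^2 - 2 |f x|^2 + |x|^2], which is at most 0 for a
    contraction that preserves the norm of [x]. *)
Lemma hadj_norm_attained x : rnorm (f x) = rnorm x -> hadj f (f x) = x.
Proof.
move=> fx; have bf := contraction_bounded.
apply/eqP; rewrite -subr_eq0; apply/eqP/rnorm0_eq0/eqP.
rewrite -sqrf_eq0 eq_le sqr_ge0 andbT -lecR -hdotxx hdotBl !hdotBr.
rewrite -[hdot x (hadj f (f x))]hadjP // [hdot (hadj f (f x)) x]hadjP_sym //.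
rewrite !hdotxx fx -!rmorphB lecR subrr subr0 subr_le0 -fx lerXn2r ?nnegrE ?rnorm_ge0 //.
exact: hadj_contraction.
Qed.

Lemma isometric_hadjK : isometric_op f -> cancel f (hadj f).
Proof. by move=> fi x; apply: hadj_norm_attained; rewrite /rnorm fi. Qed.

Hypothesis pf : partial_isometry f.

Lemma partial_isometry_hadjK y : hadj f (f (hadj f y)) = hadj f y.
Proof.
apply: hadj_norm_attained; rewrite /rnorm pf // => z fz.
by rewrite -hadjP; [rewrite fz hdot0l|exact: contraction_bounded].
Qed.

(** The vector [y - f (hadj f y)] is orthogonal to the range and, for such [y], also in its closure.
    In particular the range is closed. *)
Lemma partial_isometry_closure_range y : closure (range f) y -> f (hadj f y) = y.
Proof.
move=> cly; have bf := contraction_bounded.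
have key x : hdot (f x) (y - f (hadj f y)) = 0.
  by rewrite hadjP // (linB (hadj_linear bf)) partial_isometry_hadjK subrr hdot0r.
apply/esym/eqP; rewrite -subr_eq0; apply/eqP/rnorm0_eq0/eqP.
rewrite -sqrf_eq0; apply/eqP/complexI; rewrite -hdotxx hdotBr [X in _ - X]hdotC key rmorph0 subr0.
apply: (closure_orthogonal (D := range f)).
  by move=> _ [x _ <-]; apply: hdot_sym0.
exact: closureS (@sub_lspan _ _ _) _ cly.
Qed.

End Contraction.

(** Let [g] be any positive root of [P]. With [k = g P h - P h] one has [g k = - k], so positivity
    gives [k = 0] and [g] fixes the range of [P]; and [g g h = 0] forces [g h = 0], so [g] kills the
    kernel of [P]. *)
Lemma sqrt_op_idempotent (H : hilbert R) (P : H -> H) :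
  positive_op P -> P \o P = P -> sqrt_op P = P.
Proof.
move=> posP PP; apply: xget_unique => // g [[/bounded_linP bg posg] gg].
have lg := bg.1; have ggE x : g (g x) = P x by rewrite -gg.
have ker h : g (g h) = 0 -> g h = 0.
  move=> gk; apply: contrapT => /eqP k0; set k := g h in gk k0.
  have rk : 0 < rnorm k ^+ 2.
    by rewrite exprn_gt0 // lt_def rnorm_ge0 andbT; apply: contra_neq k0 => /rnorm0_eq0.
  have a0 := posg h; rewrite -/k in a0.
  pose a := complex.Re (hdot h k); have aE : hdot h k = a%:C%C by rewrite RRe_real // ger0_real.
  (* The coefficient of [k] is chosen to give the form of [g] the value [a - (a + 1) = -1]. *)
  have := posg (h + (- ((a + 1) / rnorm k ^+ 2))%:C%C *: k).
  rewrite (linD lg) (linZ lg) gk scaler0 addr0 hdotDl hdotZl -/k aE hdotxx.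
  rewrite conjC_real -rmorphM -rmorphD lecR.
  by rewrite mulNr divfK ?gt_eqF //; lra.
have im h : g (P h) = P h.
  pose k := g (P h) - P h.
  have gk : g k = - k.
    by rewrite /k (linB lg) ggE -[P (P h)]/((P \o P) h) PP opprB.
  have := posg k; rewrite gk -scaleN1r hdotZr mulN1r hdotxx oppr_ge0 lecR => k0.
  apply/eqP; rewrite -subr_eq0; apply/eqP/rnorm0_eq0/eqP.
  by rewrite -sqrf_eq0 eq_le k0 sqr_ge0.
apply/funext => h; rewrite -[h in LHS](subrK (P h)) (linD lg) im.
rewrite ker ?add0r // ggE (linB posP.1.1) -[P (P h)]/((P \o P) h) PP subrr //.
Qed.

End Operators.

(** * Extension by continuity *)

Section Extension.
Variable R : realType.
Local Notation C := (Cx R).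
Variables (V : normedModType C) (W : completeNormedModType C) (I : Type).
Variables (v : I -> V) (w : I -> W) (c : R).
Hypothesis c_ge0 : 0 <= c.
Hypothesis v_total : closure (lspan (range v)) = setT.
Hypothesis vw : forall n (a : 'I_n -> C) (i : 'I_n -> I),
  rnorm (\sum_k a k *: w (i k)) <= c * rnorm (\sum_k a k *: v (i k)).

(** The map is kept as a relation, since a vector of the span has many presentations. The bound [vw]
    passes to the closure of the graph and makes it single-valued; completeness of [W] makes it
    everywhere defined. *)
Let graph : set (V * W) := lspan [set p | exists i, p = (v i, w i)].
Let cl_graph x y := forall e : R, 0 < e ->
  exists2 p, graph p & rnorm (x - p.1) < e /\ rnorm (y - p.2) < e.

Let graph_bound p : graph p -> rnorm p.2 <= c * rnorm p.1.
Proof.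
move=> [n [a [u [Du ->]]]]; have [i ui] := choice Du.
have lfst : linear (@fst V W) by [].
have lsnd : linear (@snd V W) by [].
rewrite (lin_sum lfst) (lin_sum lsnd).
by under eq_bigr do rewrite ui /=; under [in leRHS]eq_bigr do rewrite ui /=.
Qed.

Let cl_graph_bound x y : cl_graph x y -> rnorm y <= c * rnorm x.
Proof.
move=> h; apply/ler_addgt0Pr => e e0.
have c1 : 0 < c + 1 by exact: ltr_wpDl.
have d0 : 0 < e / (c + 1) by exact: divr_gt0.
have [p /graph_bound gp [xp yp]] := h _ d0.
have := rnormD (y - p.2) p.2; have := rnormD (p.1 - x) x; rewrite !subrK rnormB => h1 h2.
have h3 : c * rnorm p.1 <= c * (rnorm (x - p.1) + rnorm x) by apply: ler_wpM2l.
have h4 : c * rnorm (x - p.1) <= c * (e / (c + 1)) by apply: ler_wpM2l => //; exact: ltW.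
have h5 : c * (e / (c + 1)) + e / (c + 1) = e by field; lra.
by lra.
Qed.

Let cl_graph_lin (a : C) x x' y y' :
  cl_graph x y -> cl_graph x' y' -> cl_graph (a *: x + x') (a *: y + y').
Proof.
move=> h h' e e0; have a0 := @rnorm_ge0 _ C^o a.
have d0 : 0 < e / (rnorm (a : C^o) + 1) / 2 by rewrite !divr_gt0 //; lra.
have e2 : 0 < e / 2 by rewrite divr_gt0.
have [p gp [xp yp]] := h _ d0; have [p' gp' [xp' yp']] := h' _ e2.
exists (a *: p + p'); first exact: (lspan_subspace _).2.
have key (T : normedModType C) (z z' q q' : T) :
    rnorm (z - q) < e / (rnorm (a : C^o) + 1) / 2 -> rnorm (z' - q') < e / 2 ->
    rnorm (a *: z + z' - (a *: q + q')) < e.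
  move=> zq zq'; have -> : a *: z + z' - (a *: q + q') = a *: (z - q) + (z' - q').
    by rewrite scalerBr opprD addrACA.
  apply: le_lt_trans (rnormD _ _) _; rewrite rnormZ.
  have h1 := ler_wpM2l a0 (ltW zq).
  have h2 : rnorm (a : C^o) * (e / (rnorm (a : C^o) + 1) / 2) + e / (rnorm (a : C^o) + 1) / 2 = e / 2.
    by field; lra.
  by lra.
by split; exact: key.
Qed.

Let cl_graph_total x : exists y, cl_graph x y.
Proof.
have clx : closure (lspan (range v)) x by rewrite v_total.
have approx n : exists p, graph p /\ rnorm (x - p.1) < 9^-1 ^+ n.
  have e0 : 0 < 9^-1 ^+ n :> R by rewrite exprn_gt0 // invr_gt0.
  have [u su xu] := (closure_rnormP _ _).1 clx _ e0.
  suff [p gp pu] : [set u | exists2 p, graph p & p.1 = u] u by exists p; rewrite pu.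
  apply: lspan_min su; last first.
    by move=> _ [i _ <-]; exists (v i, w i) => //; apply: sub_lspan; exists i.
  split=> [|a _ _ [p gp <-] [q gq <-]]; first by exists 0 => //; exact: (lspan_subspace _).1.
  by exists (a *: p + q) => //; exact: (lspan_subspace _).2.
have [p hp] := choice approx.
have pdist n m : (n <= m)%N -> rnorm ((p n).2 - (p m).2) <= 2 * c * 9^-1 ^+ n.
  move=> nm; have g : graph (- 1 *: p m + p n).
    by apply: (lspan_subspace _).2; [exact: (hp m).1|exact: (hp n).1].
  have := graph_bound g; rewrite /= !scaleN1r ![- _ + _]addrC => h.
  apply: le_trans h _; rewrite [2 * c]mulrC -mulrA; apply: ler_wpM2l => //.
  have -> : (p n).1 - (p m).1 = (x - (p m).1) - (x - (p n).1) by rewrite opprB [RHS]addrC addrA subrK.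
  apply: le_trans (rnormD _ _) _; rewrite rnormN.
  have := (hp n).2; have := (hp m).2.
  have : 9^-1 ^+ m <= 9^-1 ^+ n :> R by apply: ler_wiXn2l => //; lra.
  by lra.
have [y hy] : exists y : W, (fun n => (p n).2) @ \oo --> y.
  apply: cauchy_rnorm => e e0.
  have c0 := c_ge0; have c1 : 0 < 2 * c + 1 by lra.
  have d0 : 0 < e / (2 * c + 1) by exact: divr_gt0.
  have [N hN] := geometric_small d0; exists N => n Nn.
  apply: le_lt_trans (pdist _ _ Nn) _.
  have q0 : 0 < 9^-1 ^+ N :> R by rewrite exprn_gt0 // invr_gt0.
  by move: hN; rewrite ltr_pdivlMr; lra.
exists y => e e0; have [N1 hN1] := (cvgn_rnormP _ _).1 hy _ e0.
have [N2 hN2] := geometric_small e0; pose n := maxn N1 N2.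
exists (p n); first exact: (hp n).1.
split; last by apply/hN1/leq_maxl.
apply: lt_trans (hp n).2 _; apply: le_lt_trans hN2.
by apply: ler_wiXn2l; [lra|lra|exact: leq_maxr].
Qed.

Lemma bounded_extension :
  exists2 L : V -> W, bounded_lin L & forall i, L (v i) = w i.
Proof.
have [L hL] := choice cl_graph_total.
have uniq x y y' : cl_graph x y -> cl_graph x y' -> y = y'.
  move=> h h'; have := cl_graph_bound (cl_graph_lin (- 1) h' h).
  rewrite !scaleN1r addNr rnorm0 mulr0 addrC => hle.
  by apply/eqP; rewrite -subr_eq0; apply/eqP/rnorm0_eq0/le_anti; rewrite hle rnorm_ge0.
exists L; last first.
  move=> i; apply: uniq (hL _) _ => e e0; exists (v i, w i); last by rewrite !subrr !rnorm0.
  by apply: sub_lspan; exists i.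
split; last by exists c => x; exact: cl_graph_bound.
by move=> a x y; apply: uniq (hL _) _; exact: cl_graph_lin.
Qed.

End Extension.

(** * Hilbert modules *)

Section HilbertModules.
Variables (R : realType) (M : cstar_alg R).
Local Notation C := (Cx R).

Lemma rnorm_sqr (V : normedModType C) (W : normedModType C) (a : W) (x : V) :
  `|a| = `|x| ^+ 2 -> rnorm a = rnorm x ^+ 2.
Proof. by rewrite !rnormE -rmorphXn => -[]. Qed.

Lemma rnorm_cmul (a b : M) : rnorm (cmul a b) <= rnorm a * rnorm b.
Proof. by have := cnormM a b; rewrite !rnormE -rmorphM lecR. Qed.

Lemma rnorm_cstar (a : M) : rnorm (cstar a) = rnorm a.
Proof.
suff le b : rnorm b <= rnorm (cstar b :> M).
  by apply/le_anti; rewrite le andbT; have := le (cstar a); rewrite cstarK.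
have [->|b0] := eqVneq (rnorm b) 0; first exact: rnorm_ge0.
have p : 0 < rnorm b by rewrite lt_def b0 rnorm_ge0.
have := rnorm_cmul (cstar b) b; rewrite (rnorm_sqr (cnorm_star b)) expr2.
by rewrite ler_pM2r.
Qed.

Section Module.
Variable F : hilbert_module M.
Implicit Types x y z : F.

Lemma mdot_conj (c : C) x y z : mdot (c *: x + y) z = c^* *: mdot x z + mdot y z.
Proof. by rewrite mdot_star (mdot_linear z) cstar_linear -!mdot_star. Qed.

Lemma rnorm_mdot x : rnorm (mdot x x) = rnorm x ^+ 2.
Proof. exact: (rnorm_sqr (mdot_norm x)). Qed.

Lemma mdot_le x y : rnorm (mdot x y) <= 4 * rnorm x * rnorm y.
Proof. exact: sesquilinear_bound (@mdot_linear _ _ F) mdot_conj rnorm_mdot x y. Qed.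

Lemma mdot_bounded x : bounded_lin (mdot x).
Proof. by split; [exact: mdot_linear|exists (4 * rnorm x) => y; exact: mdot_le]. Qed.

Lemma mdot_eq0 x : (forall y, mdot x y = 0) -> x = 0.
Proof. exact: (sesquilinear_nondegenerate rnorm_mdot). Qed.

Lemma mdot_total_eq0 (D : set F) x : closure (lspan D) = setT ->
  (forall y, D y -> mdot x y = 0) -> x = 0.
Proof.
move=> tD h; apply: mdot_eq0 => y.
by apply: (bounded_lin_total0 (mdot_bounded x) h); rewrite tD.
Qed.

Lemma mdot_inj x y : (forall z, mdot x z = mdot y z) -> x = y.
Proof.
move=> h; apply/eqP; rewrite -subr_eq0; apply/eqP/mdot_eq0 => z.
by rewrite -scaleN1r addrC mdot_conj rmorphN rmorph1 scaleN1r h addNr.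
Qed.

Lemma mdot_sym0 x y : mdot x y = 0 -> mdot y x = 0.
Proof.
move=> xy; rewrite mdot_star xy; have := @cstar_linear R M (-1) 0 0.
by rewrite rmorphN rmorph1 !scaleN1r oppr0 addr0 addNr.
Qed.

Lemma adjoint_pair_sym (f g : F -> F) : adjoint_pair f g -> adjoint_pair g f.
Proof. by move=> fg x y; rewrite mdot_star -fg -mdot_star. Qed.

Lemma adjoint_pair_bounded (f g : F -> F) : adjoint_pair f g -> bounded_lin f.
Proof. exact: (adjoint_bounded (@mdot_linear _ _ F) mdot_conj rnorm_mdot). Qed.

Lemma rnorm_ract x (a : M) : rnorm (ract x a) <= rnorm x * rnorm a.
Proof.
rewrite -(@ler_pXn2r _ 2) ?nnegrE ?mulr_ge0 ?rnorm_ge0 // -rnorm_mdot mdot_ract.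
have -> : mdot (ract x a) x = cmul (cstar a) (mdot x x).
  by rewrite mdot_star mdot_ract cstarM -mdot_star.
apply: le_trans (rnorm_cmul _ _) _; rewrite exprMn -rnorm_mdot.
have := rnorm_cmul (cstar a) (mdot x x); rewrite rnorm_cstar => h.
have := ler_wpM2r (rnorm_ge0 a) h; rewrite expr2.
by move=> h2; apply: le_trans h2 _; rewrite mulrAC mulrC.
Qed.

End Module.

(** The case of matrices of size 1. Boundedness of [T x] ensures that the supremum in [op_mx_norm]
    is a true upper bound and not a default value. *)
Lemma completely_contractive_le (F : hilbert_module M) (H : hilbert R)
    (T : F -> H -> H) : (forall x, bounded_lin (T x)) -> completely_contractive T ->
  forall x h, rnorm (T x h) <= rnorm x * rnorm h.
Proof.
move=> bT ccT x h.
have hcol1 (k : 'I_1 -> H) : hcol_norm k = rnorm (k ord0).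
  by rewrite /hcol_norm big_ord1 sqrtr_sqr ger0_norm // rnorm_ge0.
have mcol1 (G : hilbert_module M) (k : 'I_1 -> G) : mcol_norm k = rnorm (k ord0).
  by rewrite /mcol_norm big_ord1 rnorm_mdot sqrtr_sqr ger0_norm // rnorm_ge0.
have link : linking_mx_norm (fun _ _ : 'I_1 => x) <= rnorm x.
  apply: ge_sup.
    exists (mcol_norm (fun i : 'I_1 => \sum_(j < 1) ract x (0 : M))); exists (fun=> 0) => //=.
    by rewrite mcol1 rnorm0.
  move=> _ [a /= + <-]; rewrite !mcol1 big_ord1 => a1.
  apply: le_trans (rnorm_ract _ _) _.
  by rewrite -[leRHS]mulr1; apply: ler_wpM2l => //; exact: rnorm_ge0.
have unit k : rnorm k <= 1 -> rnorm (T x k) <= rnorm x.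
  move=> k1; apply: le_trans (le_trans (ccT 1%N (fun _ _ => x)) link).
  apply: ub_le_sup; last first.
    by exists (fun=> k) => /=; rewrite hcol1 ?big_ord1.
  have [c c0 hc] := bounded_lin_pos (bT x); exists c => _ [v /= + <-].
  rewrite !hcol1 big_ord1 => v1; apply: le_trans (hc _) _.
  by rewrite -[leRHS]mulr1 ler_pM2l.
have [h0|h0] := eqVneq (rnorm h) 0.
  by rewrite (rnorm0_eq0 h0) (lin0 (bT x).1) !rnorm0 mulr0.
have p : 0 < rnorm h by rewrite lt_def h0 rnorm_ge0.
have := unit ((rnorm h)^-1%:C%C *: h); rewrite (linZ (bT x).1) !rnormZ.
rewrite rnorm_real ?invr_ge0 ?rnorm_ge0 // mulVf // => /(_ (lexx _)).
by rewrite mulrC ler_pdivrMr.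
Qed.

End HilbertModules.

(** * The Wold decomposition *)

Lemma functional_topology_continuous (R : realType) (V : choiceType)
    (F : set (V -> Cx R)) (f : V -> Cx R) : F f ->
  continuous (f : functional_topology F -> Cx R).
Proof.
move=> Ff x.
pose Tc (g : {g : V -> Cx R | F g}) := Topological.on (initial_topology (sval g)).
have /(_ (exist _ f Ff)) h :=
  (@cvg_sup V _ Tc (nbhs (x : functional_topology F)) x
    (@nbhs_filter (functional_topology F) x)).1 (fun A h => h).
apply: cvg_comp h _; exact: (@initial_continuous V (Cx R) f).
Qed.

(** Sequences supported at index 0 realize the coefficient. Their partial sums are constant only
    from [N = 1] on, hence the shift in both limits. *)
Lemma ultraweak_matrix_coefficient (R : realType) (H : hilbert R) (h k : H) :
  ultraweak_functional (fun f : H -> H => hdot h (f k)).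
Proof.
pose d (x : H) (i : nat) : H := if i is 0%N then x else 0.
have sd x : square_summable (d x).
  apply: (@cvgP _ _ (rnorm x ^+ 2)).
  rewrite -(cvg_shiftS (series _)); apply: cvg_near_cst; apply: nearW => n.
  rewrite /series /= big_nat_recl // big1 ?addr0 // => i _.
  by rewrite rnorm0 expr0n.
exists (d h), (d k); split => // f.
apply/esym/cvg_lim => //; rewrite -cvg_shiftS; apply: cvg_near_cst; apply: nearW => n.
rewrite /= big_ord_recl big1 ?addr0 // => i _.
by rewrite hdot0l.
Qed.

Lemma closure_lspan_orthogonal (R : realType) (H : hilbert R) (D : set H) :
  (forall x, (forall d, D d -> hdot d x = 0) -> x = 0) -> closure (lspan D) = setT.
Proof.
move=> h; rewrite -subTset => x _.
have [b clb xb] := exists_projection (lspan_subspace D) x.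
suff /eqP : x - b = 0 by rewrite subr_eq0 => /eqP ->.
by apply: h => d Dd; apply: xb; apply/subset_closure/sub_lspan.
Qed.

(** The space is the orthogonal sum of the closed spans of [A] and [B]; [z] lies in the second
    summand and [y] is orthogonal to it. *)
Lemma orthogonal_split (R : realType) (H : hilbert R) (A B : set H) y z :
  closure (lspan (A `|` B)) = setT -> (forall a b, A a -> B b -> hdot a b = 0) ->
  (forall a, A a -> hdot a z = 0) -> (forall b, B b -> hdot b y = 0) -> hdot y z = 0.
Proof.
move=> tAB AB Az By.
have [b clb zb] := exists_projection (lspan_subspace B) z.
suff /eqP : z - b = 0.
  rewrite subr_eq0 => /eqP ->; apply: closure_orthogonal clb => d Bd.
  exact/hdot_sym0/By.
apply: total_orthogonal0 tAB _ => d [Ad|Bd]; apply: hdot_sym0.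
  rewrite hdotBr Az // sub0r (closure_orthogonal (D := B)) ?oppr0 //.
  by move=> e Be; exact: AB.
by apply: zb; apply/subset_closure/sub_lspan.
Qed.

Section CCRep.
Variables (R : realType) (M : cstar_alg R) (s : setting M).
Variables (X : standard_product_system s) (H : hilbert R) (T : cc_rep X H).
Local Notation C := (Cx R).
Local Notation sigma := (rep0 T).

Lemma rep_bounded_lin n (x : X n) : bounded_lin (T n x).
Proof. by apply/bounded_linP; exact: rep_bounded. Qed.

Lemma rep_le n (x : X n) h : rnorm (T n x h) <= rnorm x * rnorm h.
Proof.
exact: (completely_contractive_le (@rep_bounded_lin n) (@rep_cc _ _ _ _ _ T n)).
Qed.

Lemma sigma_bounded a : bounded_lin (sigma a).
Proof. exact: (rep_bounded_lin (n := 0)). Qed.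

Lemma sigma_adj a h k : hdot (sigma a h) k = hdot h (sigma (cstar a) k).
Proof. by case: (rep_star_rep T) => _ _ + _; apply. Qed.

Lemma rep_lactE n (a : M) (x : X n) h : T n (lact a x) h = sigma a (T n x h).
Proof. by have /(congr1 (@^~ h)) := rep_lact T a x. Qed.

Lemma rep_mulE n m p (e : (n + m)%N = p) (x : X n) (y : X m) h :
  T p (ps_mul e x y) h = T n x (T m y h).
Proof. by have /(congr1 (@^~ h)) := rep_mul T e x y. Qed.

Lemma rep_lin_app n h : linear (fun x : X n => T n x h).
Proof. by move=> c x y; rewrite (rep_linear T (n := n)). Qed.

Lemma sigma_lin_app h : linear (fun a : M => sigma a h).
Proof. exact: (@rep_lin_app 0 h). Qed.

End CCRep.

(* In the W*-setting [D] is total only for the sigma-topology, from which [T p]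
   is continuous to the ultraweak topology, where matrix coefficients are
   continuous. *)
Lemma rep_total0 (R : realType) (M : cstar_alg R) (s : setting M)
    (X : standard_product_system s) (H : hilbert R) (T : cc_rep X H)
    p (D : set (X p)) h k : total_in s D ->
  (forall x, D x -> hdot h (T p x k) = 0) -> forall x, hdot h (T p x k) = 0.
Proof.
move=> tD D0 x.
have sub : is_subspace [set x | hdot h (T p x k) = 0].
  split=> [|c y z /= y0 z0] /=; first by rewrite (lin0 (rep_lin_app T k)) hdot0r.
  by rewrite (rep_lin_app T k) hdotDr hdotZr y0 z0 mulr0 addr0.
have spanD := lspan_min sub D0.
move: tD; rewrite /total_in.
have := rep_continuous T; case: s X T D x sub spanD {D0} => [|L iota vN] X T D x sub spanD.
  move=> _ tD.
  have b : bounded_lin (fun y : X p => hdot h (T p y k)   : (Cx R)^o).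
    split=> [c y z|]; first by rewrite (rep_linear T (n := p)) /= hdotDr hdotZr.
    exists (rnorm h * rnorm k) => y; apply: le_trans (cauchy_schwarz _ _) _.
    rewrite -mulrA; apply: ler_wpM2l; first exact: rnorm_ge0.
    by rewrite mulrC; exact: rep_le.
  apply: (bounded_lin_total0 b (D := D)); last by rewrite tD.
  by move=> y Dy; apply/spanD/sub_lspan.
move=> [_ cT] tD.
have clx : closure (lspan D : set (sigma_topology iota (X p))) x by rewrite tD.
have ct : continuous ((fun f : ultraweak H => hdot h (f k)) \o
    (@rep_fun _ _ _ _ _ T p : sigma_topology iota (X p) -> ultraweak H)).
  move=> y; apply: continuous_comp; first exact: cT.
  exact: (functional_topology_continuous (ultraweak_matrix_coefficient h k)).
have cl0 : closed [set 0 : Cx R].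
  move=> z /(@closure_rnormP _ (Cx R)^o) h0; apply: (@rnorm_small _ (Cx R)^o) => e e0.
  by have [_ ->] := h0 _ e0; rewrite subr0 => /ltW.
apply: ((continuous_closedP _).1 ct _ cl0).
exact: (@closureS (sigma_topology iota (X p)) (lspan D) _ _ x clx).
Qed.

Section Core.
Variables (R : realType) (M : cstar_alg R) (s : setting M).
Variables (X : standard_product_system s) (H : hilbert R) (T : cc_rep X H).
Variable K : forall n, hilbert_tensor (X n) (rep0 T).
Variable Tt : forall n, K n -> H.
Hypothesis hTt : is_tilde Tt.
Local Notation C := (Cx R).
Local Notation sigma := (rep0 T).
Local Notation tens n x h := (htens (K n) x h).

Lemma tilde_linear n : linear (Tt (n:=n)). Proof. by case: (hTt n). Qed.
Lemma tilde_contraction n (z : K n) : `|Tt z| <= `|z|. Proof. by case: (hTt n). Qed.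
Lemma tildeE n x h : Tt (tens n x h) = T n x h. Proof. by case: (hTt n). Qed.
Lemma tilde_bounded n : bounded_lin (Tt (n:=n)).
Proof. exact: (contraction_bounded (@tilde_linear n) (@tilde_contraction n)). Qed.

Lemma tilde_adjoint n x h k : hdot (tens n x h) (hadj (Tt (n:=n)) k) = hdot (T n x h) k.
Proof. by rewrite -hadjP ?tildeE //; exact: tilde_bounded. Qed.

Lemma htens_bounded n x : bounded_lin (htens (K n) x).
Proof.
split; first exact: (htens_bilin (K n)).1.
have [c c0 hc] := bounded_lin_pos (sigma_bounded T (mdot x x)).
(* From [|x (x) h|^2 <= c |h|^2]; the cruder [1 + c] avoids a square root. *)
exists (1 + c) => h; rewrite -(@ler_pXn2r _ 2) ?nnegrE ?mulr_ge0 ?rnorm_ge0 //; last by lra.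
rewrite -[leLHS](@rnorm_real R) ?sqr_ge0 // -hdotxx htens_dot.
apply: le_trans (cauchy_schwarz _ _) _.
have -> : ((1 + c) * rnorm h) ^+ 2 = rnorm h * ((1 + c) ^+ 2 * rnorm h) by ring.
apply: ler_wpM2l; first exact: rnorm_ge0.
apply: le_trans (hc _) _; apply: ler_wpM2r; first exact: rnorm_ge0.
by rewrite expr2; have := mulr_gt0 c0 c0; lra.
Qed.

(** The Gram identity says that [T~_n^* T~_n] and the identity have the same inner products on
    simple tensors, which are total. *)
Lemma isometric_of_gram n :
  (forall (x y : X n) h k, hdot (T n x h) (T n y k) = hdot h (sigma (mdot x y) k)) ->
  isometric_op (Tt (n:=n)).
Proof.
move=> gram; have bT := tilde_bounded n.
have K0 : hadj (Tt (n:=n)) \o (Tt (n:=n)) =1 id.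
  apply: (bounded_lin_eq _ _ (htens_total (K n))).
  - exact: bounded_lin_comp bT (hadj_bounded bT).
  - by split=> //; exists 1 => x; rewrite mul1r.
  move=> _ [x [h ->]] /=; apply/eqP; rewrite -subr_eq0; apply/eqP.
  apply: total_orthogonal0 (htens_total (K n)) _ => _ [y [k ->]].
  by apply: hdot_sym0; rewrite hdotBr tilde_adjoint tildeE gram htens_dot subrr.
move=> z; apply/eqP; rewrite -(@eqrXn2 _ 2) ?normr_ge0 // -!hdot_norm.
by rewrite hadjP // -[hadj _ _]/((_ \o _) z) K0.
Qed.

Definition defect h := h - Tt (hadj (Tt (n:=1)) h).

Hypothesis pT : forall n, partial_isometry (Tt (n:=n)).

Lemma hadj_defect h : hadj (Tt (n:=1)) (defect h) = 0.
Proof.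
rewrite /defect (linB (hadj_linear (tilde_bounded 1))).
rewrite (partial_isometry_hadjK (@tilde_linear 1) (@tilde_contraction 1)) //.
by rewrite subrr.
Qed.

Lemma defect_orthogonal_tilde h z : hdot (defect h) (Tt (n:=1) z) = 0.
Proof.
by apply: hdot_sym0; rewrite hadjP ?hadj_defect ?hdot0r //; exact: tilde_bounded.
Qed.

Lemma defect_idem h : defect (defect h) = defect h.
Proof. by rewrite {1}/defect hadj_defect (lin0 (@tilde_linear 1)) subr0. Qed.

Lemma defect_positive : positive_op defect.
Proof.
have bT := tilde_bounded 1.
split; first apply/bounded_linP.
  apply: bounded_linB; first by split=> //; exists 1 => x; rewrite mul1r.
  exact: bounded_lin_comp (hadj_bounded bT) bT.
move=> h; have -> : hdot h (defect h) = hdot (defect h) (defect h).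
  rewrite -{1}[h](subrK (Tt (hadj (Tt (n:=1)) h))) hdotDl.
  by rewrite [X in _ + X]hdotC defect_orthogonal_tilde rmorph0 addr0.
by rewrite hdotxx lecR sqr_ge0.
Qed.

Lemma Delta_starE : Delta_star Tt = defect.
Proof.
apply: sqrt_op_idempotent; first exact: defect_positive.
by apply/funext => h; exact: defect_idem.
Qed.

(** Products are total in [X p], and [rep_total0] propagates a vanishing matrix coefficient from
    them in both settings. *)
Lemma rep_factor n m p (e : (n + m)%N = p) h k :
  (forall (x : X n) (y : X m), hdot h (T n x (T m y k)) = 0) ->
  forall x : X p, hdot h (T p x k) = 0.
Proof.
move=> h0; have [_ _ _ _ tot] := ps_tensor X e.
by apply: rep_total0 tot _ => _ [x [y ->]]; rewrite rep_mulE.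
Qed.

Lemma defect_orthogonal_rep p (x : X p.+1) h k : hdot (defect h) (T p.+1 x k) = 0.
Proof.
move: x; apply: (rep_factor (n := 1) (m := p) erefl) => x y.
by rewrite -tildeE defect_orthogonal_tilde.
Qed.

Hypothesis wT : forall n (x : X n) h,
  hadj (Tt (n:=n)) (Tt (tens n x (defect h))) = tens n x (defect h).

(** [k] is arbitrary: only the left vector has to come from the defect space. The orthogonality
    lemma below applies this with [k] itself of the form [T v (defect k')]. *)
Lemma wandering_gram n (x y : X n) h k :
  hdot (T n x (defect h)) (T n y k) = hdot (defect h) (sigma (mdot x y) k).
Proof.
rewrite -!tildeE -hadjP_sym; last exact: tilde_bounded.
by rewrite wT htens_dot.
Qed.

Lemma wandering_orthogonal_lt n p (x : X n) (y : X p) h k : (n < p)%N ->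
  hdot (T n x (defect h)) (T p y (defect k)) = 0.
Proof.
(* The remaining degree [p - n] is written as a successor, so that [defect_orthogonal_rep] applies
   to the second factor. *)
move=> np; have e : (n + (p - n.+1).+1)%N = p by rewrite -addSnnS subnKC.
move: y; apply: (rep_factor e) => u v.
by rewrite wandering_gram -rep_lactE defect_orthogonal_rep.
Qed.

Lemma wandering_orthogonal n p (x : X n) (y : X p) h k : n != p ->
  hdot (T n x (defect h)) (T p y (defect k)) = 0.
Proof.
rewrite neq_ltn => /orP[/wandering_orthogonal_lt->//|].
by move/wandering_orthogonal_lt => h0; apply: hdot_sym0.
Qed.

Definition wandering : set H :=
  [set z | exists n (x : X n) h, z = T n x (defect h)].

Lemma range_tilde_subspace n : is_subspace (range (Tt (n:=n))).
Proof.
split; first by exists 0 => //; exact: (lin0 (@tilde_linear n)).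
by move=> c _ _ [x _ <-] [y _ <-]; exists (c *: x + y) => //; exact: tilde_linear.
Qed.

(** Degree 0 is the nondegeneracy of [sigma]. In the step, [h = T~_n T~_n^* h], and [g] is the part
    of [h] orthogonal to the range of [T~_(n+1)]. Then [T~_n^* h] is orthogonal to all [u (x) P k]
    and [T~_n^* g] to all [u (x) T_1(x) k]; these two families are orthogonal and together total, so
    [(g, h) = 0]. *)
Lemma wandering_perp_range h n : (forall d, wandering d -> hdot d h = 0) ->
  closure (range (Tt (n:=n))) h.
Proof.
move=> wh; elim: n => [|n IH].
  case: (rep_star_rep T) => _ _ _ tot.
  have : closure (lspan [set x | exists a k, x = sigma a k]) h by rewrite tot.
  apply: closureS; apply: lspan_min (range_tilde_subspace 0) _ => _ [a [k ->]].
  by exists (tens 0 a k) => //; exact: tildeE.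
have bT := tilde_bounded n.
have hE := partial_isometry_closure_range (@tilde_linear n) (@tilde_contraction n) (@pT n) IH.
have [b clb gA] := exists_projection (range_tilde_subspace n.+1) h.
set g := h - b in gA.
(* As [h - g = b] is orthogonal to [g], this inner product is the squared norm of [g]. *)
suff g0 : hdot g h = 0.
  suff /eqP : g = 0 by rewrite subr_eq0 => /eqP ->.
  apply/rnorm0_eq0/eqP; rewrite -sqrf_eq0; apply/eqP/complexI; rewrite -hdotxx.
  by rewrite {2}/g hdotBr g0 (hdot_sym0 (gA _ clb)) subr0.
rewrite -hE -hadjP_sym //.
pose A := [set z : K n | exists u k, z = tens n u (defect k)].
pose B := [set z : K n | exists u x k, z = tens n u (T 1 x k)].
apply: (orthogonal_split (A := A) (B := B)).
(* Totality comes from [k = P k + T~_1 T~_1^* k], whose second part is in the closed span of the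
   [T_1(x) k']. *)
- apply: closure_lspan_orthogonal => z ABz.
  have zperp u k : hdot z (tens n u k) = 0.
    rewrite -[k](subrK (Tt (hadj (Tt (n:=1)) k))) (linD (htens_bounded u).1) hdotDr.
    rewrite (hdot_sym0 (ABz _ (or_introl (ex_intro _ u (ex_intro _ k erefl))))) add0r.
    have bd := bounded_lin_comp
      (bounded_lin_comp (tilde_bounded 1) (htens_bounded u)) (hdot_bounded z).
    apply: (bounded_lin_total0 bd (D := [set z | exists x h, z = tens 1 x h])).
      move=> _ [x [k' ->]] /=; rewrite tildeE; apply: hdot_sym0.
      by apply: ABz; right; exists u, x, k'.
    by rewrite htens_total.
  by apply: total_orthogonal0 (htens_total (K n)) _ => _ [u [k ->]].
- move=> _ _ [u [k ->]] [v [x [k' ->]]]; rewrite htens_dot -rep_lactE.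
  exact: (defect_orthogonal_rep (p := 0)).
- by move=> _ [u [k ->]]; rewrite tilde_adjoint; apply: wh; exists n, u, k.
- move=> _ [u [x [k ->]]]; rewrite tilde_adjoint -(rep_mulE T (addn1 n)).
  by apply/gA/subset_closure; exists (tens n.+1 (ps_mul (addn1 n) u x) k) => //; rewrite tildeE.
Qed.

Hypothesis hpure : pure_rep Tt.

Lemma wandering_total : closure (lspan wandering) = setT.
Proof.
apply: closure_lspan_orthogonal => h wh; apply: rnorm_small => e e0.
have [N hN] := (cvgn_rnormP _ _).1 (hpure h) _ e0.
have := hN N (leqnn N); rewrite sub0r rnormN.
rewrite (partial_isometry_closure_range (@tilde_linear N) (@tilde_contraction N) (@pT N)).
  exact: ltW.
exact: wandering_perp_range.
Qed.

(** On wandering vectors of equal degree, both sides of the Gram identity reduce to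
    [<x (x) u, y (x) v> = <u, <x, y> v>]; in different degrees both vanish. *)
Lemma isometric_of_wandering : isometric_rep Tt.
Proof.
move=> m; apply: isometric_of_gram => x y.
have base d : wandering d -> forall k, hdot (T m x d) (T m y k) = hdot d (sigma (mdot x y) k).
  move=> [n [u [a ->]]].
  apply: (bounded_lin_eq _ _ wandering_total).
  - exact: bounded_lin_comp (rep_bounded_lin T y) (hdot_bounded _).
  - exact: bounded_lin_comp (sigma_bounded T _) (hdot_bounded _).
  move=> _ [p [v [b ->]]]; rewrite -!(rep_mulE T erefl) -rep_lactE.
  have [np|np] := eqVneq n p.
    case: p / np v => v; rewrite !wandering_gram.
    have [_ dotE _ _ _] := ps_tensor X (erefl (m + n)%N).
    by rewrite -dotE.
  by rewrite !wandering_orthogonal // eqn_add2l.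
(* Conjugation makes the first argument linear, so that the same density argument applies to it. *)
move=> h k; rewrite hdotC [RHS]hdotC; congr (_^*); move: h.
apply: (bounded_lin_eq _ _ wandering_total).
- exact: bounded_lin_comp (rep_bounded_lin T x) (hdot_bounded _).
- exact: hdot_bounded.
by move=> d wd; rewrite hdotC base // -hdotC.
Qed.

End Core.

(** * Isometric and relatively isometric representations *)

Section RelativelyIsometric.
Variables (R : realType) (M : cstar_alg R) (s : setting M).
Variables (X : standard_product_system s) (H : hilbert R) (T : cc_rep X H).
Variable K : forall n, hilbert_tensor (X n) (rep0 T).
Variable Tt : forall n, K n -> H.
Hypothesis hTt : is_tilde Tt.

Lemma isometric_partial_isometry : isometric_rep Tt ->
  forall n, partial_isometry (Tt (n:=n)).
Proof. by move=> iso n x _; exact: iso. Qed.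

(** The adjoint of an isometry is onto, so condition (a) is immediate. *)
Lemma isometric_relatively_isometric : isometric_rep Tt -> relatively_isometric Tt.
Proof.
move=> iso; split; first exact: isometric_partial_isometry.
left=> n z _; exists (Tt z) => //.
exact: (isometric_hadjK (tilde_linear hTt (n := n)) (tilde_contraction hTt (n := n)) (iso n)).
Qed.

(** Under (a) the vector lies in the range of [T~_n^*], where [T~_n^* T~_n] is the identity. Under
    (b), paired with [P h], the map [T~_n] preserves its norm, and a contraction fixes such vectors
    in this sense. *)
Lemma relatively_isometric_wandering : relatively_isometric Tt ->
  forall n (x : X n) h, hadj (Tt (n:=n)) (Tt (htens (K n) x (defect Tt h))) =
    htens (K n) x (defect Tt h).
Proof.
move=> [pT ab] n x h.
have lT := tilde_linear hTt (n := n); have cT := tilde_contraction hTt (n := n).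
case: ab => [a|b].
  have : range (hadj (Tt (n:=n))) (htens (K n) x (Delta_star Tt h)).
    by apply: a; apply/subset_closure/sub_lspan; exists x, h.
  rewrite Delta_starE // => -[y _ <-].
  exact: partial_isometry_hadjK.
apply: hadj_norm_attained => //; apply/eqP; rewrite -(@eqrXn2 _ 2) ?rnorm_ge0 //.
apply/eqP/complexI; rewrite -!hdotxx tildeE // htens_dot.
rewrite -[LHS]hadjP_sym; last exact: rep_bounded_lin.
have := b n x h; rewrite Delta_starE // => bE.
have dsym u v : hdot (defect Tt u) v = hdot u (defect Tt v).
  have bT := tilde_bounded hTt 1.
  by rewrite /defect hdotBl hdotBr (hadjP bT) -(hadjP_sym bT).
rewrite -[defect Tt h in X in hdot _ X]defect_idem // -dsym bE sigma_adj.
by rewrite -mdot_star.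
Qed.

Lemma relatively_isometric_isometric : pure_rep Tt ->
  relatively_isometric Tt -> isometric_rep Tt.
Proof.
move=> hp rel; apply: isometric_of_wandering => //; first exact: rel.1.
exact: relatively_isometric_wandering.
Qed.
End RelativelyIsometric.

(** * Representations of the Toeplitz algebra *)

(** Iterated squaring gives [(b 1 / a) ^ (2 ^ n) <= b (2 ^ n) / a <= c ^ (2 ^ n) * B / a]. If
    [q = b 1 / (c a)] exceeded 1, its powers would be unbounded by Bernoulli; the size of [B] is
    irrelevant after taking roots. *)
Lemma doubling_bound (R : realType) (a B c : R) (b : nat -> R) :
  0 <= a -> 0 < c -> (forall m, 0 <= b m) ->
  (forall m, b m ^+ 2 <= a * b (m + m)%N) -> (forall m, b m <= c ^+ m * B) ->
  b 1%N <= c * a.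
Proof.
move=> a0 c0 b0 bb bB.
have [az|an0] := eqVneq a 0.
  have := bb 1%N; rewrite az mulr0 mul0r => h.
  have : b 1%N ^+ 2 == 0 by rewrite eq_le h sqr_ge0.
  by rewrite sqrf_eq0 => /eqP ->.
have ap : 0 < a by rewrite lt_def an0.
rewrite leNgt; apply/negP => h.
pose q := b 1%N / (c * a).
have q1 : 1 < q by rewrite ltr_pdivlMr ?mulr_gt0 // mul1r.
have iter n : a * (b 1%N / a) ^+ (2 ^ n) <= b (2 ^ n)%N.
  elim: n => [|n IH]; first by rewrite expr1 mulrC divfK.
  have := bb (2 ^ n)%N; rewrite addnn -mul2n -expnS => h2.
  rewrite -(ler_pM2l ap); apply: le_trans h2.
  rewrite expnSr exprM mulrA -expr2 -exprMn lerXn2r ?nnegrE //.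
  by rewrite mulr_ge0 // exprn_ge0 // divr_ge0.
have qB n : q ^+ (2 ^ n) <= B / a.
  rewrite ler_pdivlMr // -(ler_pM2l (exprn_gt0 (2 ^ n) c0)).
  apply: le_trans (bB _); apply: le_trans (iter n).
  rewrite mulrA -exprMn mulrC.
  have -> : c * q = b 1%N / a by rewrite /q; field; rewrite !gt_eqF.
  by [].
have bern n : 1 + (q - 1) *+ n <= q ^+ n.
  elim: n => [|n IH]; first by rewrite mulr0n addr0.
  rewrite exprS; have := ler_wpM2l (ltW (lt_trans ltr01 q1)) IH.
  have : 0 <= (q - 1) *+ n by rewrite mulrn_wge0 // subr_ge0 ltW.
  rewrite mulrSr => p1 p2; apply: le_trans p2.
  have : 0 <= (q - 1) * ((q - 1) *+ n) by rewrite mulr_ge0 // subr_ge0 ltW.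
  by lra.
have [n hn] : exists n : nat, B / a / (q - 1) < n%:R.
  exists (Num.bound (B / a / (q - 1))); apply: archi_boundP.
  apply: divr_ge0; last by rewrite subr_ge0 ltW.
  by apply: le_trans (qB 0%N); rewrite expr1 ltW // (lt_trans ltr01).
move: hn; rewrite ltr_pdivrMr ?subr_gt0 // => hn.
have := qB n; have := bern (2 ^ n)%N.
have : (q - 1) *+ n <= (q - 1) *+ (2 ^ n).
  by apply: ler_wpMn2l; [rewrite subr_ge0 ltW|exact/ltnW/ltn_expl].
by rewrite -[_ *+ n]mulr_natl; lra.
Qed.

(** Places the Toeplitz algebra inside the adjointable maps, on all of which the representation will
    be built. *)
Lemma adjointable_subalgebra (R : realType) (M : cstar_alg R)
    (X : standard_product_system (@CStarSetting R M)) (F : fock X) :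
  cstar_subalgebra (F := F) (@adjointable R M F).
Proof.
split=> //.
- split; first by
    exists (fun=> 0) => x y; rewrite (lin0 (@mdot_linear _ _ _ x)) mdot_sym0 // (lin0 (@mdot_linear _ _ _ y)).
  move=> c f g [f' ff'] [g' gg']; exists (c^* *: f' + g') => x y /=.
  rewrite mdot_conj ff' gg' (linD (@mdot_linear _ _ _ x)).
  by rewrite (linZ (@mdot_linear _ _ _ x)).
- by move=> f g [f' ff'] [g' gg']; exists (g' \o f') => x y /=; rewrite ff' gg'.
- by move=> f g _ fg; exists f; exact: adjoint_pair_sym.
Qed.

Section ToeplitzAlgebra.
Variables (R : realType) (M : cstar_alg R).
Variables (X : standard_product_system (@CStarSetting R M)) (F : fock X).

Lemma toeplitz_adjointable f : toeplitz (F:=F) f -> adjointable f.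
Proof.
by apply; [exact: adjointable_subalgebra|exact: shift_adjointable].
Qed.

Lemma toeplitz_shift n (x : X n) : toeplitz (F:=F) (Defs.shift (f:=F) x).
Proof. by move=> B _; apply. Qed.

Lemma toeplitz_adjoint f g : toeplitz (F:=F) f -> adjoint_pair f g -> toeplitz (F:=F) g.
Proof.
by move=> tf fg B sB shB; case: (sB) => _ _ _ aB _; apply: (aB f) => //; exact: tf.
Qed.

(** Agreement on homogeneous vectors is carried over to the adjoints, whose values are determined by
    inner products with those vectors. *)
Lemma adjointable_eq_total (f g : F -> F) : adjointable f -> adjointable g ->
  (forall n (x : X n), f (fock_in F x) = g (fock_in F x)) -> f = g.
Proof.
move=> [f' ff'] [g' gg'] fg; apply/funext => x; apply: mdot_inj => y.
rewrite ff' gg'; congr mdot; apply/eqP; rewrite -subr_eq0; apply/eqP.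
apply: mdot_total_eq0 (fock_total F) _ => _ [n [z ->]]; apply: mdot_sym0.
by rewrite (linB (@mdot_linear _ _ _ _)) -ff' -gg' fg subrr.
Qed.

Lemma shift_adjoint_shift n (x y : X n) g : adjoint_pair (Defs.shift (f:=F) x) g ->
  g \o Defs.shift (f:=F) y = Defs.shift (f:=F) (mdot x y : X 0%N).
Proof.
move=> xg; apply: adjointable_eq_total.
- have [y' yy'] := shift_adjointable F y.
  by exists (y' \o Defs.shift (f:=F) x) => u v /=; rewrite (adjoint_pair_sym xg) yy'.
- exact: shift_adjointable.
move=> m z /=; rewrite !shiftE ps_mul0l; apply/eqP; rewrite -subr_eq0; apply/eqP.
apply: mdot_total_eq0 (fock_total F) _ => _ [k [u ->]]; apply: mdot_sym0.
rewrite (linB (@mdot_linear _ _ _ _)) -xg shiftE.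
have [km|km] := eqVneq k m; last first.
  by rewrite !fock_in_ortho ?subrr // eqn_add2l.
case: m / km z => z; rewrite !fock_in_dot.
by have [_ -> _ _ _] := ps_tensor X (erefl (n + k)%N); rewrite subrr.
Qed.
End ToeplitzAlgebra.

Section ToeplitzExtension.
Variables (R : realType) (M : cstar_alg R).
Variables (X : standard_product_system (@CStarSetting R M)) (H : hilbert R).
Variable T : cc_rep X H.
Variable K : forall n, hilbert_tensor (X n) (rep0 T).
Variable Tt : forall n, K n -> H.
Hypothesis hTt : is_tilde Tt.
Variable F : fock X.
Local Notation C := (Cx R).
Local Notation sigma := (rep0 T).

Lemma extends_isometric : extends_to_toeplitz F T -> isometric_rep Tt.
Proof.
move=> [pi [[_ _ piM piS _] piT]] n; apply: isometric_of_gram => // x y h k.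
have [g xg] := shift_adjointable F x.
have tx := toeplitz_shift (F:=F) x; have tg := toeplitz_adjoint tx xg.
rewrite -piT (piS _ _ tx xg) -[T n y]piT.
have /(congr1 (@^~ k)) /= <- := piM _ _ tg (toeplitz_shift (F:=F) y).
by rewrite (shift_adjoint_shift y xg) piT.
Qed.

Hypothesis iso : isometric_rep Tt.
Hypothesis hpure : pure_rep Tt.
Let pT := isometric_partial_isometry iso.
Let wT := relatively_isometric_wandering hTt (isometric_relatively_isometric hTt iso).
Local Notation D := (defect Tt).
Local Notation eta n x := (@fock_in _ _ _ _ F n x).

Lemma fock_gram n m (x : X n) (y : X m) h k :
  hdot (T n x (D h)) (T m y (D k)) =
  hdot (D h) (sigma (mdot (eta n x) (eta m y)) (D k)).
Proof.
have [nm|nm] := eqVneq n m.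
  by case: m / nm y => y; rewrite fock_in_dot wandering_gram.
by rewrite fock_in_ortho // (wandering_orthogonal hTt pT wT) // (lin0 (sigma_lin_app T (D k))) hdot0r.
Qed.

(** The inner product of [x (x) P h] and [y (x) P k] in [F_X (x)_sigma Im P]. That space is not
    built; [H] itself hosts it. *)
Let sigma_form h k : F -> F -> C := fun x y => hdot (D h) (sigma (mdot x y) (D k)).

Lemma sigma_form_bounded h k x : bounded_lin (sigma_form h k x : F -> C^o).
Proof.
split=> [c y z|].
  by rewrite /sigma_form mdot_linear (sigma_lin_app T (D k)) hdot_linear.
exists (rnorm (D h) * (4 * rnorm x * rnorm (D k))) => y.
apply: le_trans (cauchy_schwarz _ _) _; rewrite -mulrA; apply: ler_wpM2l.
  exact: rnorm_ge0.
apply: le_trans (rep_le T _ _) _; rewrite mulrAC; apply: ler_wpM2r; first exact: rnorm_ge0.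
exact: mdot_le.
Qed.

Lemma sigma_formC h k x y : sigma_form h k x y = (sigma_form k h y x)^*.
Proof. by rewrite /sigma_form -hdotC sigma_adj -mdot_star. Qed.

(** [U x] plays the role of [x (x) P h]. By [fock_gram] the squared norm of a combination is
    [(P h, sigma(<u, u>) P h)], whence the constant [rnorm (D h)]. *)
Lemma exists_fock_lift h : exists2 U : F -> H, bounded_lin U &
  forall n (x : X n), U (eta n x) = T n x (D h).
Proof.
pose v (i : {n & X n}) := eta (tag i) (tagged i).
pose w (i : {n & X n}) := T (tag i) (tagged i) (D h).
have [|||U bU hU] := @bounded_extension R F H _ v w (rnorm (D h)).
- exact: rnorm_ge0.
- rewrite -[RHS](fock_total F); congr (closure (lspan _)).
  apply/seteqP; split=> [_ [[n x] _ <-]|_ [n [x ->]]]; first by exists n, x.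
  by exists (existT _ n x).
- move=> n a i; set z := \sum_k _; set u := \sum_k _.
  have step j : hdot (w j) z = sigma_form h h (v j) u.
    rewrite /z /u (lin_sum (hdot_lin _)) (lin_sum (sigma_form_bounded h h (v j)).1).
    apply: eq_bigr => k _; rewrite (linZ (hdot_lin _)) (linZ (sigma_form_bounded h h (v j)).1).
    by rewrite fock_gram.
  have zz : hdot z z = sigma_form h h u u.
    rewrite {2}/z {2}/u (lin_sum (hdot_lin _)) (lin_sum (sigma_form_bounded h h u).1).
    apply: eq_bigr => k _; rewrite (linZ (hdot_lin _)) (linZ (sigma_form_bounded h h u).1).
    by rewrite hdotC step [in RHS]sigma_formC.
  rewrite -(@ler_pXn2r _ 2) ?nnegrE ?mulr_ge0 ?rnorm_ge0 //.
  rewrite -[leLHS](@rnorm_real R) ?sqr_ge0 // -hdotxx zz.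
  apply: le_trans (cauchy_schwarz _ _) _; rewrite exprMn expr2 -mulrA; apply: ler_wpM2l.
    exact: rnorm_ge0.
  by apply: le_trans (rep_le T _ _) _; rewrite rnorm_mdot mulrC.
exists U => // n x; exact: (hU (existT _ n x)).
Qed.

Section Lift.
Variable U : H -> F -> H.
Hypothesis bU : forall h, bounded_lin (U h).
Hypothesis U_eta : forall h n (x : X n), U h (eta n x) = T n x (D h).

Lemma lift_gram h k x y : hdot (U h x) (U k y) = sigma_form h k x y.
Proof.
have base h' k' n (z : X n) y' : hdot (U h' (eta n z)) (U k' y') = sigma_form h' k' (eta n z) y'.
  move: y'; apply: (bounded_lin_eq (bounded_lin_comp (bU k') (hdot_bounded _))
    (sigma_form_bounded _ _ _) (fock_total F)) => _ [m [y' ->]] /=.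
  by rewrite !U_eta fock_gram.
move: y; apply: (bounded_lin_eq (bounded_lin_comp (bU k) (hdot_bounded _))
  (sigma_form_bounded _ _ _) (fock_total F)) => _ [m [y' ->]] /=.
by rewrite hdotC base -sigma_formC.
Qed.

Lemma lift_le h x : rnorm (U h x) <= rnorm x * rnorm (D h).
Proof.
rewrite -(@ler_pXn2r _ 2) ?nnegrE ?mulr_ge0 ?rnorm_ge0 //.
rewrite -[leLHS](@rnorm_real R) ?sqr_ge0 // -hdotxx lift_gram.
apply: le_trans (cauchy_schwarz _ _) _.
have -> : (rnorm x * rnorm (D h)) ^+ 2 = rnorm (D h) * (rnorm x ^+ 2 * rnorm (D h)) by ring.
apply: ler_wpM2l; first exact: rnorm_ge0.
by apply: le_trans (rep_le T _ _) _; rewrite rnorm_mdot.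
Qed.

Lemma lift_total : closure (lspan (range (fun p : F * H => U p.2 p.1))) = setT.
Proof.
rewrite -subTset -(wandering_total hTt pT hpure).
apply: closureS; apply: lspan_min (lspan_subspace _) _ => _ [n [x [h ->]]].
by apply: sub_lspan; exists (eta n x, h) => //=; exact: U_eta.
Qed.

Lemma lift_adjoint (f g : F -> F) h k x y : adjoint_pair f g ->
  hdot (U h (f x)) (U k y) = hdot (U h x) (U k (g y)).
Proof. by move=> fg; rewrite !lift_gram /sigma_form fg. Qed.

(* Boundedness of [sum_k a_k U x_k |-> sum_k a_k U (f x_k)]: with [G = f^* f],
   the norms [b m] of the images of [G^m] satisfy [b m ^ 2 <= b 0 * b (2 m)] and
   grow at most geometrically, whence [b 1 <= c * b 0]. *)
Lemma exists_induced_operator f : adjointable f ->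
  exists2 L : H -> H, bounded_lin L & forall h x, L (U h x) = U h (f x).
Proof.
move=> [g fg]; have gf := adjoint_pair_sym fg.
pose G := g \o f.
have GG : adjoint_pair G G by move=> x y; rewrite /G /= gf fg.
have [c c0 hc] := bounded_lin_pos (adjoint_pair_bounded GG).
have Gm m : adjoint_pair (iter m G) (iter m G).
  elim: m => [|m IH] x y //=; first by rewrite GG IH -iterS iterSr.
have Gc m x : rnorm (iter m G x) <= c ^+ m * rnorm x.
  elim: m => [|m IH]; first by rewrite mul1r.
  by apply: le_trans (hc _) _; rewrite exprS -mulrA ler_pM2l.
(* Below, [|z|^2 <= |z'| * b 1 <= c |z'|^2], and [1 + c] dominates the square root of [c]. *)
have [|||L bL hL] := @bounded_extension R H H _ (fun p : F * H => U p.2 p.1)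
   (fun p => U p.2 (f p.1)) (1 + c); last by exists L => // h x; exact: (hL (x, h)).
- by lra.
- exact: lift_total.
move=> n a i; set z := \sum_k _; set z' := \sum_k _.
(* The would-be value of [phi (x) 1] at [z']. The presentation of [z'] stays fixed, because
   independence of it is not yet known. *)
pose S (phi : F -> F) := \sum_k a k *: U (i k).2 (phi (i k).1).
have S_adj phi phi' psi : adjoint_pair phi phi' ->
    hdot (S phi) (S psi) = hdot (S id) (S (phi' \o psi)).
  move=> pp; have key k y h : hdot (U (i k).2 (phi (i k).1)) (U h y) =
      hdot (U (i k).2 (i k).1) (U h (phi' y)) by exact: lift_adjoint.
  rewrite /S !(lin_sum (hdot_lin _)); apply: eq_bigr => k _.
  rewrite !hdotZr hdotC [in RHS]hdotC !(lin_sum (hdot_lin _)); congr (_ * _^*).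
  by apply: eq_bigr => j _; rewrite !hdotZr hdotC key -hdotC.
pose b m := rnorm (S (iter m G)).
(* This depends on the presentation, which is harmless: [doubling_bound] removes it. *)
pose B := \sum_k rnorm (a k : C^o) * (rnorm (i k).1 * rnorm (D (i k).2)).
have h1 : b 1%N <= c * rnorm z'.
  apply: (doubling_bound (B := B)) => [|//||m|m]; first exact: rnorm_ge0.
  - by move=> m; exact: rnorm_ge0.
  - rewrite /b -[leLHS](@rnorm_real R) ?sqr_ge0 // -hdotxx (S_adj _ _ _ (Gm m)).
    have -> : iter m G \o iter m G = iter (m + m) G.
      by apply/funext => x; rewrite iterD.
    exact: cauchy_schwarz.
  - apply: le_trans (rnorm_sum _ _) _; rewrite mulr_sumr; apply: ler_sum => k _.
    rewrite rnormZ mulrCA; apply: ler_wpM2l; first exact: rnorm_ge0.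
    apply: le_trans (lift_le _ _) _; rewrite mulrA; apply: ler_wpM2r; first exact: rnorm_ge0.
    exact: Gc.
have z'0 := rnorm_ge0 z'.
rewrite -(@ler_pXn2r _ 2) ?nnegrE ?mulr_ge0 ?rnorm_ge0 //; last by lra.
rewrite -[leLHS](@rnorm_real R) ?sqr_ge0 // -hdotxx (S_adj _ _ _ fg).
apply: le_trans (cauchy_schwarz _ _) _.
have h2 : rnorm z' * b 1%N <= rnorm z' * (c * rnorm z') by apply: ler_wpM2l.
apply: le_trans h2 _.
have := mulr_ge0 (mulr_ge0 z'0 z'0) (mulr_ge0 (ltW c0) (ltW c0)).
have := mulr_ge0 (mulr_ge0 z'0 z'0) (ltW c0); have := mulr_ge0 z'0 z'0.
by rewrite !expr2; lra.
Qed.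

End Lift.

Lemma isometric_extends : extends_to_toeplitz F T.
Proof.
have lift h : exists U : F -> H,
    bounded_lin U /\ forall n (x : X n), U (eta n x) = T n x (D h).
  by have [U] := exists_fock_lift h; exists U.
have [U0 hU0] := choice lift.
have bU h := (hU0 h).1; have Ueta h n x := (hU0 h).2 n x.
(* The choice is made over all maps, with [id] as a placeholder off the adjointable ones. *)
have ind f : exists L : H -> H, adjointable f ->
    bounded_lin L /\ forall h x, L (U0 h x) = U0 h (f x).
  have [/(exists_induced_operator bU Ueta)[L bL hL]|nf] := pselect (adjointable f).
    by exists L.
  by exists id.
have [pi hpi] := choice ind.
have bpi f : adjointable f -> bounded_lin (pi f) by move=> /hpi[].
have piE f h x : adjointable f -> pi f (U0 h x) = U0 h (f x) by move=> /hpi[_]; apply.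
have tot := lift_total Ueta.
(* The vectors [U0 h x] are total, so an operator is known from its action on them; linearity and
   multiplicativity of [pi] follow from this uniqueness. *)
have pi_eq f L : adjointable f -> bounded_lin L -> (forall h x, L (U0 h x) = U0 h (f x)) ->
    pi f = L.
  move=> af bL hL; apply/funext; apply: (bounded_lin_eq (bpi _ af) bL tot) => _ [[x h] _ <-] /=.
  by rewrite piE // hL.
have [_ [_ sZ] sM _ _] := adjointable_subalgebra F.
have piT n (x : X n) : pi (Defs.shift (f:=F) x) = T n x.
  have ax := shift_adjointable F x; apply/funext.
  apply: (bounded_lin_eq (bpi _ ax) (rep_bounded_lin T x) (wandering_total hTt pT hpure)).
  move=> _ [m [y [h ->]]]; rewrite -Ueta piE // shiftE !Ueta.
  exact: rep_mulE.
exists pi; split=> //; split.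
- by move=> f /toeplitz_adjointable/bpi/bounded_linP.
- move=> c f g /toeplitz_adjointable af /toeplitz_adjointable ag.
  apply: pi_eq; first exact: sZ.
    exact: bounded_lin_comb (bpi _ af) (bpi _ ag).
  by move=> h x; rewrite (bU h).1 -!piE.
- move=> f g /toeplitz_adjointable af /toeplitz_adjointable ag.
  apply: pi_eq; first exact: sM.
    exact: bounded_lin_comp (bpi _ ag) (bpi _ af).
  by move=> h x /=; rewrite !piE.
- move=> f g /toeplitz_adjointable af fg.
  have ag : adjointable g by exists f; exact: adjoint_pair_sym.
  have base h x k : hdot (pi f (U0 h x)) k = hdot (U0 h x) (pi g k).
    move: k; apply: (bounded_lin_eq (hdot_bounded _)
      (bounded_lin_comp (bpi _ ag) (hdot_bounded _)) tot) => _ [[y k] _ <-] /=.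
    by rewrite !piE //; exact: (lift_adjoint bU Ueta).
  move=> h k; rewrite hdotC [RHS]hdotC; congr (_^*); move: h.
  apply: (bounded_lin_eq (bounded_lin_comp (bpi _ af) (hdot_bounded _))
    (hdot_bounded _) tot) => _ [[x h] _ <-] /=.
  by rewrite hdotC base -hdotC.
(* Nondegeneracy is inherited from [sigma], since [pi] sends the shift by [a] of degree 0 to
   [sigma a]. *)
- rewrite -subTset; case: (rep_star_rep T) => _ _ _ <-.
  apply: closureS; apply: lspan_min (lspan_subspace _) _ => _ [a [h ->]].
  apply: sub_lspan; exists (Defs.shift (f:=F) (a : X 0%N)); first exact: toeplitz_shift.
  by exists h; rewrite piT.
Qed.
End ToeplitzExtension.

Theorem proposition3p4 (R : realType) (M : cstar_alg R) (s : setting M)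
    (X : standard_product_system s) (H : hilbert R) (T : cc_rep X H)
    (K : forall n : nat, hilbert_tensor (X n) (rep0 T))
    (Tt : forall n : nat, K n -> H) (hTt : is_tilde Tt) (hpure : pure_rep Tt) :
  (isometric_rep Tt <-> relatively_isometric Tt) /\
  (s = CStarSetting ->
    forall F : fock X, isometric_rep Tt <-> extends_to_toeplitz F T).
Proof.
split.
  split; first exact: isometric_relatively_isometric.
  exact: relatively_isometric_isometric.
move=> s_eq; subst s => F; split; last exact: extends_isometric.
by move=> iso; exact: (isometric_extends hTt F iso hpure).
Qed.
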